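(* Let $G=\mathrm{Spin}(m)$ be the real Spin group, with Lie algebra $\mathfrak g$ identified with $\mathfrak{so}(m)$, and let $p_1\in I^2(\mathfrak g)$ be the first Pontryagin polynomial. For $n\ge 0$ let $\chi_n=\int_{\Delta^n}p_1\circ(\kappa_n\wedge\kappa_n)\in\Omega^{4-n}(EG_n)$ be the forms obtained by applying Shulman's construction to $p_1$. Then $$\chi_1=\frac{1}{24\pi^2}\,\mathrm{Tr}(\bar\omega_1\cdot\bar\omega_1\cdot\bar\omega_1),$$ $$\chi_2=\frac{1}{8\pi^2}\left(\mathrm{Tr}(\bar\omega_1\cdot\bar\omega_2)-\mathrm{Tr}(\bar\omega_1)\cdot\mathrm{Tr}(\bar\omega_2)\right),$$ $$\chi_n=0\quad\text{for all } n\neq 1,2,$$ where $\bar\omega_i=\omega_i-\omega_0$.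
   Context: $\mathrm{Spin}(m)$ (denoted $\mathrm{Sp}(m)$ in the source) is the subgroup $\{v_1\cdots v_{2k}: v_i\in\mathbb R^m,\ |v_i|=1\}\cup\{\pm1\}$ of the Clifford algebra of $\mathbb R^m$ with relation $v\cdot v=-|v|^2\cdot 1$; it is a double cover $\pi:\mathrm{Spin}(m)\to SO(m)$. Via $d\pi$ its Lie algebra is identified with $\mathfrak{so}(m)$ (skew-symmetric $m\times m$ matrices); its left Maurer-Cartan form $\omega$ is then the $\mathfrak{so}(m)$-valued form sending $v\in T_p\mathrm{Spin}(m)$ to $\pi(p)^{-1}\cdot\pi_*v$. The Pontryagin polynomials are defined by $\det\left(t\cdot\mathrm{id}-\frac1{2\pi}A\right)=\sum_{k=0}^m p_{k/2}(A,\dots,A)\,t^{m-k}$, where $p_{k/2}$ is the symmetric $k$-linear form obtained by polarization; $p_1$ is the case $k=2$. $I^k(\mathfrak g)$ denotes the symmetric $k$-linear $\mathrm{Ad}$-invariant forms on $\mathfrak g$. $\Delta^n=\{(t_0,\dots,t_n)\in\mathbb R^{n+1}:\sum t_i=1,\ t_i\ge0\}$, oriented by $(t_1,\dots,t_n)$. $EG_n=G^{n+1}$, and $\omega_j$ is the pullback of $\omega$ along the $j$-th projection $G^{n+1}\to G$, $j=0,\dots,n$ (also pulled back to $\Delta^n\times EG_n$). On $\Delta^n\times EG_n$ let $\hat\omega_n=\sum_{j=0}^n t_j\,\omega_j$ and $\kappa_n=d\hat\omega_n+\frac12[\hat\omega_n\wedge\hat\omega_n]$. Shulman's construction associates to $f\in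 I^k(\mathfrak g)$ the forms $\chi_n(f)=\int_{\Delta^n}f\circ\bigwedge^k\kappa_n$ on $EG_n$. Integration along the fiber $\Delta^n$ of a $k$-form $\phi$ on $\Delta^n\times M$: $\left(\int_{\Delta^n}\phi\right)_p(u_1,\dots,u_{k-n})=\int_{\Delta^n\times\{p\}}\phi(\cdot,\dots,\cdot,\tilde u_1,\dots,\tilde u_{k-n})$, with $\tilde u_i$ lifts of $u_i$ in the last slots (and the result is $0$ if $n>k$). Wedge conventions: for a $V$-valued $j$-form $\phi$ and a $W$-valued $k$-form $\psi$, $(\phi\wedge\psi)(v_1,\dots,v_{j+k})=\frac{1}{j!k!}\sum_{\sigma\in\mathfrak S_{j+k}}\mathrm{sign}(\sigma)\,\phi(v_{\sigma(1)},\dots)\otimes\psi(v_{\sigma(j+1)},\dots)$; $[\phi\wedge\psi]$ is the same with $\otimes$ replaced by the Lie bracket. For a multilinear map $f$, $f\circ\bigwedge\phi_i=f(\phi_1,\dots,\phi_k)$ means the induced linear map on the tensor product composed with $\phi_1\wedge\dots\wedge\phi_k$. So $\mathrm{Tr}(\phi\cdot\psi\cdot\chi)$, $\mathrm{Tr}(\phi\cdot\psi)$, $\mathrm{Tr}(\phi)\cdot\mathrm{Tr}(\psi)$ come from the multilinear maps $\mathrm{Tr}(ABC)$, $\mathrm{Tr}(AB)$, $\mathrm{Tr}(A)\mathrm{Tr}(B)$. *)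

(* Defs.v *)
From HB Require Import structures.
From mathcomp Require Import all_boot all_order all_algebra all_fingroup.
From mathcomp Require Import all_classical all_reals all_analysis ring lra.

Set Implicit Arguments.
Unset Strict Implicit.
Unset Printing Implicit Defensive.

Import Order.TTheory GRing.Theory Num.Theory.
Import numFieldNormedType.Exports.

Local Open Scope classical_set_scope.
Local Open Scope ring_scope.

(* The coordinates are those in the basis e_S = e_(s_1) ... e_(s_r), where
   S = {s_1 < ... < s_r} ranges over the subsets of 'I_m. *)
Definition cliff (R : realType) (m : nat) : Type := 'rV[R]_#|{set 'I_m}|.

HB.instance Definition _ (R : realType) m :=
  NormedModule.copy (cliff R m) 'rV[R]_#|{set 'I_m}|.

Section Clifford.
Variables (R : realType) (m : nat).
Implicit Types (x y z : cliff R m) (S T U : {set 'I_m}).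

Definition clcoord S x : R := x ord0 (enum_rank S).

Definition mkcl (f : {set 'I_m} -> R) : cliff R m := \row_k f (enum_val k).

Definition symdiff S T := (S :\: T) :|: (T :\: S).

(* e_S e_T = (-1)^c(S,T) e_(S symdiff T), where c(S,T) counts the transpositions
   e_i e_j = - e_j e_i (i > j) and the squares e_i^2 = -1 needed to sort the
   product. *)
Definition clexp S T : nat := (\sum_(i in S) \sum_(j in T | j <= i) 1)%N.

Definition clmul x y : cliff R m := mkcl (fun U =>
  \sum_S (-1) ^+ clexp S (symdiff S U) * clcoord S x * clcoord (symdiff S U) y).

Definition clone : cliff R m := mkcl (fun S => (S == finset.set0)%:R).

Lemma clcoordE f S : clcoord S (mkcl f) = f S.
Proof. by rewrite /clcoord mxE enum_rankK. Qed.

Lemma clcoordP x y : (forall S, clcoord S x = clcoord S y) -> x = y.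
Proof.
move=> h; apply/rowP => k; rewrite -(enum_valK k); exact: h.
Qed.

Lemma clcoordD S x y : clcoord S (x + y) = clcoord S x + clcoord S y.
Proof. by rewrite /clcoord mxE. Qed.

Lemma clcoordZ S a x : clcoord S (a *: x) = a * clcoord S x.
Proof. by rewrite /clcoord mxE. Qed.

Lemma in_symdiff i S T : (i \in symdiff S T) = (i \in S) (+) (i \in T).
Proof. by rewrite !inE; case: (i \in S); case: (i \in T). Qed.

Lemma symdiffA S T U : symdiff S (symdiff T U) = symdiff (symdiff S T) U.
Proof. by apply/setP => i; rewrite !in_symdiff addbA. Qed.

Lemma symdiffC S T : symdiff S T = symdiff T S.
Proof. by apply/setP => i; rewrite !in_symdiff addbC. Qed.

Lemma symdiffK S : cancel (symdiff S) (symdiff S).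
Proof. by move=> T; apply/setP => i; rewrite !in_symdiff addbA addbb. Qed.

Lemma symdiff0 S : symdiff S finset.set0 = S.
Proof. by apply/setP => i; rewrite in_symdiff inE addbF. Qed.

Lemma symdiff0l S : symdiff finset.set0 S = S.
Proof. by rewrite symdiffC symdiff0. Qed.

Lemma symdiffxx S : symdiff S S = finset.set0.
Proof. by apply/setP => i; rewrite in_symdiff addbb inE. Qed.


Lemma clexpE S T :
  clexp S T = (\sum_i \sum_j [&& i \in S, j \in T & (j <= i)%N])%N.
Proof.
rewrite /clexp big_mkcond; apply: eq_bigr => i _.
case: ifP => iS /=; last by rewrite big1.
by rewrite big_mkcond; apply: eq_bigr => j _; case: ifP.
Qed.

Lemma sgn_odd (n k : nat) : odd n = odd k -> (-1) ^+ n = (-1) ^+ k :> R.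
Proof. by move=> h; rewrite -signr_odd h signr_odd. Qed.

Lemma odd_sum (I : finType) (F : I -> nat) :
  odd (\sum_i F i)%N = \big[addb/false]_i odd (F i).
Proof. exact: (big_morph odd oddD). Qed.

Lemma odd_clexpD1 S T U :
  odd (clexp (symdiff S T) U) = odd (clexp S U) (+) odd (clexp T U).
Proof.
rewrite -oddD !clexpE -big_split /= !odd_sum; apply: eq_bigr => i _.
rewrite -big_split /= !odd_sum; apply: eq_bigr => j _.
by rewrite oddD !oddb in_symdiff; do !case: (_ \in _); case: (_ <= _)%N.
Qed.

Lemma odd_clexpD2 S T U :
  odd (clexp S (symdiff T U)) = odd (clexp S T) (+) odd (clexp S U).
Proof.
rewrite -oddD !clexpE -big_split /= !odd_sum; apply: eq_bigr => i _.
rewrite -big_split /= !odd_sum; apply: eq_bigr => j _.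
by rewrite oddD !oddb in_symdiff; do !case: (_ \in _); case: (_ <= _)%N.
Qed.

Lemma clmulA : associative clmul.
Proof.
move=> x y z; apply: clcoordP => U; rewrite !clcoordE.
under eq_bigr => S _ do rewrite clcoordE mulr_sumr.
under [RHS]eq_bigr => S _ do rewrite clcoordE mulr_sumr mulr_suml.
rewrite [RHS]exchange_big /=; apply: eq_bigr => S _.
rewrite [RHS](reindex_inj (can_inj (symdiffK S))) /=; apply: eq_bigr => T _.
rewrite symdiffK -!symdiffA.
set W := symdiff T _.
have -> : symdiff S (symdiff T U) = W by rewrite {}/W !symdiffA (symdiffC S T).
have -> : clexp S (symdiff S U) = clexp S (symdiff T W).
  by rewrite {}/W symdiffK.
set a := clcoord S x; set b := clcoord _ y; set c := clcoord _ z.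
have -> : (-1) ^+ clexp S (symdiff T W) * a * ((-1) ^+ clexp T W * b * c) =
    (-1) ^+ (clexp S (symdiff T W) + clexp T W) * (a * b * c).
  rewrite exprD; move: ((-1) ^+ _) ((-1) ^+ _) => p q; ring.
have -> : (-1) ^+ clexp (symdiff S T) W * ((-1) ^+ clexp S T * a * b) * c =
    (-1) ^+ (clexp (symdiff S T) W + clexp S T) * (a * b * c).
  rewrite exprD; move: ((-1) ^+ _) ((-1) ^+ _) => p q; ring.
congr (_ * _); apply: sgn_odd; rewrite !oddD odd_clexpD1 odd_clexpD2.
by rewrite -addbA addbC.
Qed.

Lemma clexp0l S : clexp finset.set0 S = 0%N.
Proof. by rewrite /clexp big_set0. Qed.

Lemma clexp0r S : clexp S finset.set0 = 0%N.
Proof.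
by rewrite /clexp big1 // => i _; rewrite big_pred0 // => j; rewrite inE.
Qed.

Lemma clmul1l : left_id clone clmul.
Proof.
move=> x; apply: clcoordP => U.
rewrite clcoordE (bigD1 finset.set0) //= big1 => [|S /negbTE S0].
  by rewrite clexp0l clcoordE eqxx symdiff0l addr0 !mul1r.
by rewrite clcoordE S0 mulr0 mul0r.
Qed.

Lemma clmul1r : right_id clone clmul.
Proof.
move=> x; apply: clcoordP => U.
rewrite clcoordE (bigD1 U) //= big1 => [|S /negbTE SU].
  by rewrite symdiffxx clexp0r clcoordE eqxx addr0 mul1r mulr1.
rewrite clcoordE; case: eqP => [SU0|_]; last by rewrite mulr0.
by move: SU; rewrite -(symdiffK S U) SU0 symdiff0 eqxx.
Qed.

Lemma clmulDl : left_distributive clmul +%R.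
Proof.
move=> x y z; apply: clcoordP => U; rewrite clcoordD !clcoordE -big_split /=.
by apply: eq_bigr => S _; rewrite clcoordD mulrDr mulrDl.
Qed.

Lemma clmulDr : right_distributive clmul +%R.
Proof.
move=> x y z; apply: clcoordP => U; rewrite clcoordD !clcoordE -big_split /=.
by apply: eq_bigr => S _; rewrite clcoordD mulrDr.
Qed.

Lemma clone_neq0 : clone != 0.
Proof.
apply/eqP => /(congr1 (clcoord finset.set0)).
by rewrite clcoordE eqxx /clcoord mxE => /eqP; rewrite oner_eq0.
Qed.

Lemma clscaleAl (a : R) x y : a *: clmul x y = clmul (a *: x) y.
Proof.
apply: clcoordP => U; rewrite clcoordZ !clcoordE mulr_sumr.
by apply: eq_bigr => S _; rewrite clcoordZ !mulrA [a * _]mulrC -!mulrA.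
Qed.

Lemma clscaleAr (a : R) x y : a *: clmul x y = clmul x (a *: y).
Proof.
apply: clcoordP => U; rewrite clcoordZ !clcoordE mulr_sumr.
by apply: eq_bigr => S _; rewrite clcoordZ mulrCA.
Qed.

End Clifford.

HB.instance Definition _ (R : realType) m :=
  GRing.Zmodule_isNzRing.Build (cliff R m)
    (@clmulA R m) (@clmul1l R m) (@clmul1r R m)
    (@clmulDl R m) (@clmulDr R m) (@clone_neq0 R m).
HB.instance Definition _ (R : realType) m :=
  GRing.Lmodule_isLalgebra.Build R (cliff R m) (@clscaleAl R m).
HB.instance Definition _ (R : realType) m :=
  GRing.Lalgebra_isAlgebra.Build R (cliff R m) (@clscaleAr R m).

Section Spin.
Variables (R : realType) (m : nat).
Implicit Types (x y p : cliff R m) (S T U : {set 'I_m}) (u v w : 'rV[R]_m).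

Definition clbasis S : cliff R m := mkcl (fun T => (T == S)%:R).

Definition clvec v : cliff R m := \sum_i v ord0 i *: clbasis [set i]%SET.

(* The norm `|v| of 'rV[R]_m is the supremum norm. *)
Definition enorm v : R := Num.sqrt (\sum_j v ord0 j ^+ 2).

Lemma clcoord_sum S (I : finType) (P : pred I) (F : I -> cliff R m) :
  clcoord S (\sum_(i | P i) F i) = \sum_(i | P i) clcoord S (F i).
Proof. by rewrite /clcoord summxE. Qed.

Lemma clbasisP x : x = \sum_S clcoord S x *: clbasis S.
Proof.
apply: clcoordP => T; rewrite clcoord_sum (bigD1 T) //= big1 => [|S ST].
  by rewrite clcoordZ clcoordE eqxx mulr1 addr0.
by rewrite clcoordZ clcoordE eq_sym (negbTE ST) mulr0.
Qed.

Lemma clbasisM S T :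
  clbasis S * clbasis T = (-1) ^+ clexp S T *: clbasis (symdiff S T).
Proof.
apply: clcoordP => U; rewrite clcoordZ [LHS]clcoordE (bigD1 S) //=.
rewrite big1 => [|V VS].
  rewrite addr0 !clcoordE eqxx mulr1; case: eqP => [SUT|SUT].
    by rewrite -SUT symdiffK eqxx !mulr1.
  by case: eqP => [UST|]; rewrite ?mulr0 //; case: SUT; rewrite UST symdiffK.
by rewrite clcoordE (negbTE VS) mulr0 mul0r.
Qed.

Lemma clbasis0 : clbasis finset.set0 = 1.
Proof. by []. Qed.

Lemma clexp11 (i j : 'I_m) : clexp [set i]%SET [set j]%SET = (j <= i)%N.
Proof.
rewrite /clexp big_set1 big_mkcondr big_set1.
by case: (j <= i)%N.
Qed.

Lemma clgen_sqr (i : 'I_m) : clbasis [set i]%SET * clbasis [set i]%SET = -1.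
Proof. by rewrite clbasisM clexp11 leqnn symdiffxx clbasis0 scaleN1r. Qed.

Lemma clgen_anti (i j : 'I_m) : i != j ->
  clbasis [set i]%SET * clbasis [set j]%SET
  = - (clbasis [set j]%SET * clbasis [set i]%SET).
Proof.
move=> ij; rewrite !clbasisM !clexp11 symdiffC -scaleNr.
congr (_ *: _); have := ltn_neqAle i j; rewrite ltnNge -(inj_eq val_inj) in ij *.
by rewrite ij /=; case: (leqP j i) => _ <-; rewrite ?opprK.
Qed.

Lemma clvec_anticomm u v :
  clvec u * clvec v + clvec v * clvec u
  = - (2 * \sum_i u ord0 i * v ord0 i)%:A.
Proof.
have E a b : clvec a * clvec b = \sum_i \sum_j (a ord0 i * b ord0 j) *:
    (clbasis [set i]%SET * clbasis [set j]%SET).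
  rewrite /clvec mulr_suml; apply: eq_bigr => i _; rewrite mulr_sumr.
  by apply: eq_bigr => j _; rewrite -scalerAl -scalerAr scalerA.
rewrite !E [X in _ + X]exchange_big -big_split /=.
rewrite mulr_sumr scaler_suml -sumrN; apply: eq_bigr => i _.
rewrite -big_split /= (bigD1 i) //= big1 => [|j ji].
  rewrite clgen_sqr !scalerN addr0 -opprD; congr (- _).
  by rewrite -scalerDl; congr (_ *: _); ring.
by rewrite clgen_anti 1?eq_sym // [v _ _ * _]mulrC scalerN addNr.
Qed.

Lemma clvec_sqr v : clvec v * clvec v = - (enorm v ^+ 2)%:A.
Proof.
have := clvec_anticomm v v; rewrite -mulr2n -scaler_nat -scalerA => h.
have n2 : (2 : R) != 0 by rewrite pnatr_eq0.
apply: (scalerI n2); rewrite h scalerN; congr (- (_ *: _%:A)).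
rewrite sqr_sqrtr; last by apply: sumr_ge0 => i _; exact: sqr_ge0.
by apply: eq_bigr => i _; rewrite expr2.
Qed.

(* Transposition: the antiautomorphism reversing products of vectors. *)
Definition clrev x : cliff R m :=
  mkcl (fun S => (-1) ^+ 'C(#|S|, 2) * clcoord S x).

Definition spin : set (cliff R m) :=
  [set p | (exists k (v : 'I_k.*2 -> 'rV[R]_m),
      (forall i, enorm (v i) = 1) /\ p = \prod_i clvec (v i))
    \/ p = 1 \/ p = -1].

(* The matrix of x |-> p x p^-1 on R^m, as p^-1 = clrev p on Spin(m)
   (spin_mulVr, spin_conj). Written with clrev it is polynomial in p, hence
   smooth on the whole Clifford algebra. *)
Definition spin_cover p : 'M[R]_m :=
  \matrix_(i, j) clcoord [set i]%SET (p * clbasis [set j]%SET * clrev p).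

Lemma clrevD x y : clrev (x + y) = clrev x + clrev y.
Proof. by apply: clcoordP => S; rewrite clcoordD !clcoordE clcoordD mulrDr. Qed.

Lemma clrevZ a x : clrev (a *: x) = a *: clrev x.
Proof. by apply: clcoordP => S; rewrite clcoordZ !clcoordE clcoordZ mulrCA. Qed.

Lemma clrev_sum (I : finType) (F : I -> cliff R m) :
  clrev (\sum_i F i) = \sum_i clrev (F i).
Proof.
apply: clcoordP => S; rewrite clcoordE !clcoord_sum mulr_sumr.
by apply: eq_bigr => i _; rewrite clcoordE.
Qed.

Lemma clrev_basis S : clrev (clbasis S) = (-1) ^+ 'C(#|S|, 2) *: clbasis S.
Proof.
apply: clcoordP => T; rewrite clcoordZ !clcoordE.
by case: eqP => [->|]; rewrite ?mulr0.
Qed.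

Lemma card_sum S : #|S| = (\sum_(i : 'I_m) (i \in S))%N.
Proof.
by rewrite -sum1_card big_mkcond; apply: eq_bigr => i _; case: ifP.
Qed.

Lemma clexp_xx S : (clexp S S + clexp S S = #|S| * #|S| + #|S|)%N.
Proof.
rewrite {1}clexpE clexpE [X in (_ + X)%N]exchange_big /= card_sum.
rewrite big_distrl /= -!big_split /=; apply: eq_bigr => i _.
rewrite big_distrr -big_split /=.
case: (boolP (i \in S)) => iS /=; last first.
  by rewrite !big1 // => j _; rewrite ?andbF.
rewrite (bigD1 i) //= [in RHS](bigD1 i) //= iS leqnn [RHS]addnAC.
congr (_ + _)%N; apply: eq_bigr => j ji; rewrite mul1n; case: (j \in S) => //=.
by rewrite -(inj_eq val_inj) /= in ji; case: ltngtP ji.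
Qed.

Lemma odd_bin_card S : odd 'C(#|S|, 2) = odd (clexp S S + #|S|).
Proof.
have h n : ('C(n, 2) + 'C(n, 2) = n * n.-1)%N.
  rewrite addnn bin2 -[RHS]odd_double_half oddM.
  by case: n => //= n; rewrite andNb.
have -> : clexp S S = 'C(#|S|.+1, 2).
  by apply: double_inj; rewrite -!addnn clexp_xx h /= mulSn addnC.
by rewrite binS bin1 -addnA oddD addnn odd_double addbF.
Qed.

Lemma clrevM x y : clrev (x * y) = clrev y * clrev x.
Proof.
rewrite (clbasisP x) (clbasisP y) !clrev_sum mulr_suml clrev_sum mulr_sumr.
apply: eq_bigr => S _; rewrite mulr_sumr mulr_suml clrev_sum.
apply: eq_bigr => T _; rewrite !clrevZ -!scalerAl -!scalerAr !clrevZ.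
rewrite scalerA [RHS]scalerA [_ * clcoord T y]mulrC; congr (_ *: _).
rewrite clbasisM clrevZ !clrev_basis -!scalerAl -!scalerAr clbasisM.
rewrite symdiffC !scalerA; congr (_ *: _).
rewrite -!exprD; apply: sgn_odd; rewrite !oddD !odd_bin_card !oddD.
have -> : odd #|symdiff T S| = odd #|T| (+) odd #|S|.
  rewrite !card_sum !odd_sum -big_split /=.
  by apply: eq_bigr => i _; rewrite in_symdiff; do !case: (_ \in _).
rewrite odd_clexpD1 !odd_clexpD2.
move: (odd (clexp S S)) (odd (clexp S T)) (odd (clexp T S)) (odd (clexp T T)).
by move: (odd #|S|) (odd #|T|) => [] [] [] [] [] [].
Qed.

Lemma clrev1 : clrev 1 = 1.
Proof. by rewrite -clbasis0 clrev_basis cards0 scale1r. Qed.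

Lemma clrevN x : clrev (- x) = - clrev x.
Proof. by rewrite -scaleN1r clrevZ scaleN1r. Qed.

Lemma clrev_vec v : clrev (clvec v) = clvec v.
Proof.
rewrite /clvec clrev_sum; apply: eq_bigr => i _.
by rewrite clrevZ clrev_basis cards1 scale1r.
Qed.

Lemma clvec_unit v : enorm v = 1 -> clvec v * clvec v = -1.
Proof. by move=> v1; rewrite clvec_sqr v1 expr1n scale1r. Qed.

Lemma spin_mulVr p : spin p -> p * clrev p = 1 /\ clrev p * p = 1.
Proof.
case=> [[k [v [v1 ->]]]|].
  elim: k v v1 => [|k IH] v v1; first by rewrite big_ord0 clrev1 mulr1.
  rewrite !big_ord_recl.
  set q := \prod_(i < _) _; set a := clvec _; set b := clvec _.
  have [qq' q'q] : q * clrev q = 1 /\ clrev q * q = 1.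
    exact: (IH (fun i => v (lift ord0 (lift ord0 i)))).
  have a2 : a * a = -1 by apply: clvec_unit.
  have b2 : b * b = -1 by apply: clvec_unit.
  rewrite !clrevM !clrev_vec -/a -/b; split.
    rewrite -!mulrA (mulrA q) qq' mul1r (mulrA b) b2 mulrA mulrN1 mulNr a2.
    by rewrite opprK.
  rewrite !mulrA -(mulrA _ a a) a2 mulrN1 mulNr -(mulrA _ b b) b2 mulrN1 opprK.
  exact: q'q.
by case=> ->; rewrite ?clrevN clrev1 ?mulrNN mulr1.
Qed.

Lemma clcoord_vec (i : 'I_m) v : clcoord [set i]%SET (clvec v) = v ord0 i.
Proof.
rewrite clcoord_sum (bigD1 i) //= big1 => [|j ji].
  by rewrite clcoordZ clcoordE eqxx mulr1 addr0.
rewrite clcoordZ clcoordE; case: eqP => [/set1_inj ij|]; last by rewrite mulr0.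
by rewrite ij eqxx in ji.
Qed.

Lemma clvec_delta (j : 'I_m) : clvec (delta_mx ord0 j) = clbasis [set j]%SET.
Proof.
rewrite /clvec (bigD1 j) //= mxE !eqxx scale1r big1 ?addr0 // => i ij.
by rewrite mxE (negbTE ij) andbF scale0r.
Qed.

(* Conjugation by a unit vector is a reflection up to sign. *)
Lemma clvec_conj u v : enorm u = 1 ->
  exists w, clvec u * clvec v * clvec u = clvec w.
Proof.
move=> u1; exists (v - (2 * \sum_i u ord0 i * v ord0 i) *: u).
have -> : clvec u * clvec v = - (2 * \sum_i u ord0 i * v ord0 i)%:A
    - clvec v * clvec u by rewrite -clvec_anticomm addrK.
rewrite mulrBl -mulrA clvec_unit // mulrN1 opprK mulNr -scalerAl mul1r addrC.
rewrite /clvec scaler_sumr -sumrN -big_split /=; apply: eq_bigr => i _.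
by rewrite !mxE scalerBl scalerA.
Qed.

Lemma spin_conj p v : spin p ->
  p * clvec v * clrev p = clvec (v *m (spin_cover p)^T).
Proof.
move=> sp; have ex w : exists w', p * clvec w * clrev p = clvec w'.
  case: sp => [[k [a [a1 ->]]]|[]->]; last 2 first.
  - by exists w; rewrite clrev1 mul1r mulr1.
  - by exists w; rewrite clrevN clrev1 mulN1r mulrNN mulr1.
  elim: k.*2 a a1 => [|n IH] a a1.
    by exists w; rewrite big_ord0 clrev1 mul1r mulr1.
  rewrite big_ord_recl clrevM clrev_vec.
  have [w' e] := IH (fun i => a (lift ord0 i)) (fun i => a1 _).
  have [w'' e'] := clvec_conj w' (a1 ord0).
  by exists w''; rewrite -e' -e !mulrA.
have {}ex w : exists2 w', p * clvec w * clrev p = clvec w' &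
    forall i, w' ord0 i = clcoord [set i]%SET (p * clvec w * clrev p).
  by have [w' e] := ex w; exists w' => // i; rewrite e clcoord_vec.
have [w' e w'E] := ex v; rewrite e; congr clvec; apply/rowP => i; rewrite w'E [RHS]mxE.
rewrite /clvec mulr_sumr mulr_suml clcoord_sum; apply: eq_bigr => j _.
by rewrite -scalerAr -scalerAl clcoordZ !mxE.
Qed.

End Spin.

(* A W-valued k-form on a submanifold X (possibly with corners) of a vector
   space V is represented by a smooth k-form on a neighbourhood of X in V.
   Two representatives define the same form on X when they agree at the points
   of X on vectors tangent to X. Since exterior derivatives, wedge products and
   pullbacks commute with restriction to X, they are computed on
   representatives. The type does not record multilinearity, alternation or
   smoothness. *)
Definition form (R : realType) (V W : normedModType R) (k : nat) : Type :=
  V -> ('I_k -> V) -> W.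

Section Forms.
Variable R : realType.

Definition tangent (V : normedModType R) (X : set V) (p v : V) : Prop :=
  exists c : R -> V, [/\ c 0 = p, forall s, X (c s) & is_derive (0 : R) (1 : R) c v].

Definition eq_form (V W : normedModType R) (X : set V) k
    (phi psi : form V W k) : Prop :=
  forall (p : V) (v : 'I_k -> V), X p -> (forall i, tangent X p (v i)) ->
    phi p v = psi p v.

Definition pullback (V V' W : normedModType R) (f : V -> V') k
    (phi : form V' W k) : form V W k :=
  fun p v => phi (f p) (fun i => 'D_(v i) f p).

Definition dform (V W : normedModType R) k (phi : form V W k) : form V W k.+1 :=
  fun p v => \sum_(i < k.+1)
    (-1) ^+ i *: 'D_(v i) (fun q => phi q (fun j => v (lift i j))) p.

(* The wedge product followed by the linear map on the tensor product induced
   by a bilinear map b. *)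
Definition wedge (V W1 W2 W : normedModType R) (b : W1 -> W2 -> W) j k
    (phi : form V W1 j) (psi : form V W2 k) : form V W (j + k) :=
  fun p v => (j`!%:R * k`!%:R)^-1 *: \sum_(s : 'S_(j + k))
    (-1) ^+ odd_perm s *: b (phi p (fun i => v (s (lshift k i))))
                            (psi p (fun i => v (s (rshift j i)))).

(* \int ... \int F dt_n ... dt_1, with F 0 for n = 0. *)
Fixpoint iter_integral n : ('rV[R]_n -> R) -> R :=
  match n with
  | 0 => fun F => F 0
  | n'.+1 => fun F => Rintegral lebesgue_measure setT (fun x : R =>
      iter_integral (fun t : 'rV[R]_n' => F (row_mx (x%:M : 'rV[R]_1) t)))
  end.

(* Delta^n is parametrized by (t_1, ..., t_n), with t_0 = 1 - \sum_i t_i. *)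
Definition std_simplex n : set 'rV[R]_n :=
  [set t | (forall i, 0 <= t ord0 i) /\ \sum_i t ord0 i <= 1].

Definition barycentric n (t : 'rV[R]_n) : 'rV[R]_n.+1 :=
  row_mx ((1 - \sum_i t ord0 i)%:M : 'rV[R]_1) t.

(* The coordinate field d/dt_(i+1) of this parametrization. *)
Definition partial n (i : 'I_n) : 'rV[R]_n.+1 :=
  delta_mx ord0 (lift ord0 i) - delta_mx ord0 ord0.

(* The first n arguments are the coordinate fields of Delta^n, in the order
   d/dt_1, ..., d/dt_n giving its orientation; the others are the lifts (0, u_l).
   The innermost default is never reached when n <= k. *)
Definition fiber_integral n k (V : normedModType R)
    (phi : form ('rV[R]_n.+1 * V)%type R k) : form V R (k - n) :=
  fun p u =>
    let args (i : 'I_k) : 'rV[R]_n.+1 * V :=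
      if insub (val i) is Some j then (partial (j : 'I_n), 0)
      else if insub (i - n)%N is Some l then (0, u l) else 0 in
    if (n <= k)%N then
      iter_integral (fun t => \1_(@std_simplex n) t * phi (barycentric t, p) args)
    else 0.

End Forms.

Section Pontryagin.
Variables (R : realType) (m : nat).

(* The coefficient of t^(m-k) in det(t id - A / 2 pi); there is none if k > m. *)
Definition pontryagin_coef k (A : 'M[R]_m) : R :=
  if (k <= m)%N then (char_poly ((2 * pi)^-1 *: A))`_(m - k) else 0.

Definition polarization (V : lmodType R) k (P : V -> R) (A : 'I_k -> V) : R :=
  (k`!%:R)^-1 * \sum_(S : {set 'I_k}) (-1) ^+ (k - #|S|) * P (\sum_(i in S) A i).

(* This is p_(k/2). *)
Definition pontryagin k : ('I_k -> 'M[R]_m) -> R :=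
  polarization (pontryagin_coef k).

Definition p1 (A B : 'M[R]_m) : R :=
  pontryagin (fun i : 'I_2 => tnth [tuple A; B] i).

End Pontryagin.

Section Shulman.
Variables (R : realType) (m : nat).

Definition bracket (A B : 'M[R]_m) : 'M[R]_m := A *m B - B *m A.

(* The value at p is the form pi(p)^-1 pi_* v of the Lie group when v is tangent
   to Spin(m). As pi(p) is invertible for p near Spin(m), this formula is smooth
   there and serves as representative of the Maurer-Cartan form. *)
Definition maurer_cartan : form (cliff R m) 'M[R]_m 1 :=
  fun p v => invmx (spin_cover p) *m 'D_(v ord0) (@spin_cover R m) p.

(* The factors of EG_n = G^(n+1) are the rows of a matrix. *)
Definition EGspace n : normedModType R := 'M[R]_(n.+1, #|{set 'I_m}|).

Definition EG n : set (EGspace n) :=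
  [set p | forall j, spin (row j p : cliff R m)].

Definition omega n (j : 'I_n.+1) : form (EGspace n) 'M[R]_m 1 :=
  pullback (fun p : EGspace n => row j p : cliff R m) maurer_cartan.

Definition omega_hat n : form ('rV[R]_n.+1 * EGspace n)%type 'M[R]_m 1 :=
  fun p v => \sum_j p.1 ord0 j *: pullback snd (omega j) p v.

Definition kappa n : form ('rV[R]_n.+1 * EGspace n)%type 'M[R]_m 2 :=
  fun p v => dform (@omega_hat n) p v
    + 2^-1 *: wedge bracket (@omega_hat n) (@omega_hat n) p v.

(* The forms attached to a symmetric invariant bilinear form f. *)
Definition shulman (f : 'M[R]_m -> 'M[R]_m -> R) n : form (EGspace n) R (4 - n) :=
  fiber_integral (wedge f (@kappa n) (@kappa n)).

Definition omega_bar n (i : 'I_n.+1) : form (EGspace n) 'M[R]_m 1 :=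
  fun p v => omega i p v - omega ord0 p v.

End Shulman.

Arguments maurer_cartan R m : clear implicits.
Arguments EG R m n : clear implicits.
Arguments omega R m n j : clear implicits.
Arguments omega_bar R m n i : clear implicits.
Arguments omega_hat R m n : clear implicits.
Arguments kappa R m n : clear implicits.
Arguments shulman {R m} f n.

(* Main.v *)
Require Import Defs.
From HB Require Import structures.
From mathcomp Require Import all_boot all_order all_algebra all_fingroup.
From mathcomp Require Import all_classical all_reals all_analysis.
From mathcomp Require Import ring lra.

Set Implicit Arguments.
Unset Strict Implicit.
Unset Printing Implicit Defensive.

Import Order.TTheory GRing.Theory Num.Theory.
Import numFieldNormedType.Exports.

Local Open Scope classical_set_scope.
Local Open Scope ring_scope.

(** Two facts make the computation finite. The second coefficient of the
    characteristic polynomial is an elementary symmetric function of the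
    eigenvalues, so that p_1(A, B) = (Tr A Tr B - Tr AB) / (8 pi^2) (p1E). The
    curvature is explicit: pi(p) is quadratic in p and invertible on Spin(m),
    hence omega = pi^-1 d pi satisfies d omega = - [omega /\ omega] / 2 there,
    and kappa_n is the sum of the terms dt_j /\ omega_j and of the curvature of
    the convex combination sum_j t_j omega_j of the flat connections omega_j
    (kappaE).

    Call a tangent vector of Delta^n x EG_n vertical when it is tangent to
    Delta^n, horizontal when it is tangent to EG_n. Then kappa_n vanishes on two
    vertical vectors, equals bar omega_i on d/dt_i and a horizontal vector, and
    for n = 1 equals (s^2 - s) [bar omega_1(u), bar omega_1(w)] on two
    horizontal vectors u and w, where s = t_1. Evaluating p_1(kappa_n /\ kappa_n)
    on four vectors gives twice the alternating sum over the three ways of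
    pairing them (wedge22), and the fibre integral feeds in n vertical vectors.

    - If n = 3 or n = 4, every pairing of four vectors, at least three of them
      vertical, joins two vertical ones, and the integrand vanishes; if n > 4,
      the dimension of the fibre exceeds the degree; if n = 0, a single flat
      connection has no curvature.
    - If n = 2, only the pairings of vertical with horizontal vectors survive.
      The integrand is constant on a triangle of area 1/2 and gives the
      opposite of p_1(bar omega_1 /\ bar omega_2).
    - If n = 1, the integrand is 2 (s^2 - s) times the sum over the cyclic
      permutations of p_1(bar omega_1(u), [bar omega_1(v), bar omega_1(w)]) for
      the three horizontal vectors u, v, w. The traces of the brackets vanish,
      the cubic traces are cyclically invariant, and the integral of
      2 (s^2 - s) over [0, 1] is -1/3. *)

(** * The first Pontryagin form in terms of traces *)

Lemma deriv_prod (R : comNzRingType) (I : eqType) (r : seq I)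
    (F : I -> {poly R}) :
  uniq r ->
  (\prod_(i <- r) F i)^`()
  = \sum_(i <- r) (F i)^`() * \prod_(j <- r | j != i) F j.
Proof.
elim: r => [|i r IH] /=; first by rewrite !big_nil derivC.
case/andP=> ir ur; rewrite !big_cons derivM IH // eqxx /=; congr (_ * _ + _).
  rewrite [RHS]big_seq_cond [LHS]big_seq_cond; apply: eq_bigl => j.
  by case: eqVneq => [->|]; rewrite ?(negbTE ir) ?andbF.
rewrite mulr_sumr; apply: eq_big_seq => j jr.
rewrite big_cons ifT; first by rewrite mulrCA.
by apply: contraNneq ir => ->.
Qed.

(** Jacobi's formula: differentiating the i-th row of X - A leaves the i-th unit
    vector, so the Leibniz expansion of the derivative collects the diagonal
    cofactors. *)
Lemma deriv_char_poly (R : comNzRingType) n (A : 'M[R]_n) :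
  (char_poly A)^`() = \tr (\adj (char_poly_mx A)).
Proof.
rewrite /char_poly /determinant raddf_sum /mxtrace.
under [RHS]eq_bigr => i _ do rewrite mxE expand_cofactor.
under [RHS]eq_bigr => i _ do rewrite big_mkcond.
rewrite [RHS]exchange_big; apply: eq_bigr => s _ /=.
have -> : forall p : {poly R}, ((-1) ^+ s * p)^`() = (-1) ^+ s * p^`().
  by move=> p; case: (odd_perm s); rewrite ?mulN1r ?derivN ?mul1r.
rewrite deriv_prod ?index_enum_uniq // mulr_sumr; apply: eq_bigr => i _.
rewrite !mxE derivB derivC subr0 derivMn derivX [s i == i]eq_sym.
case: eqP => _; last by rewrite mul0r mulr0.
by rewrite mul1r; congr (_ * _); apply: eq_bigl => j; rewrite eq_sym.
Qed.

Section AdjCoef.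
Variables (R : comNzRingType) (n : nat) (A : 'M[R]_n).

(** The matrix B_k in adj (X - A) = sum_k B_k X^k. *)
Definition adj_coef k : 'M[R]_n :=
  \matrix_(i, j) (\adj (char_poly_mx A) i j)`_k.

(** This is the coefficient of X^k in (X - A) adj (X - A) = det (X - A). *)
Lemma adj_coefX k :
  \matrix_(i, j) ('X * \adj (char_poly_mx A) i j)`_k
  = A *m adj_coef k + ((char_poly A)`_k)%:M.
Proof.
have /matrixP e := mul_mx_adj (char_poly_mx A).
apply/matrixP => i j; move: (e i j) => /(congr1 (fun p : {poly R} => p`_k)).
rewrite -/(char_poly A) !mxE coefMn => <-.
have step l : char_poly_mx A i l * \adj (char_poly_mx A) l j =
    'X *+ (i == l) * \adj (char_poly_mx A) l j
    - (A i l)%:P * \adj (char_poly_mx A) l j by rewrite !mxE mulrBl.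
have diag : \sum_l 'X *+ (i == l) * \adj (char_poly_mx A) l j =
    'X * \adj (char_poly_mx A) i j.
  rewrite (bigD1 i) //= eqxx mulr1n big1 ?addr0 // => l.
  by rewrite eq_sym => /negbTE ->; rewrite mulr0n mul0r.
rewrite (eq_bigr _ (fun l _ => step l)) sumrB diag coefB coef_sum.
rewrite addrC -[LHS](subrK (\sum_l A i l * adj_coef k l j)).
congr (_ - _ + _); first by rewrite mxE.
by apply: eq_bigr => l _; rewrite coefCM !mxE.
Qed.

(** The trace of the coefficient of X^k in X adj (X - A) is known from Jacobi's
    formula; comparing it with adj_coefX gives the recursion of
    Faddeev and Le Verrier. *)
Lemma tr_mul_adj_coef k :
  (char_poly A)`_k *+ k = \tr (A *m adj_coef k) + (char_poly A)`_k *+ n.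
Proof.
rewrite -(mxtrace_scalar n) -mxtraceD -adj_coefX /mxtrace.
under eq_bigr => i _ do rewrite mxE.
rewrite -coef_sum -mulr_sumr coefXM; case: k => [//|k] /=.
by rewrite -coef_deriv deriv_char_poly.
Qed.

Lemma adj_coef_pred k :
  adj_coef k = A *m adj_coef k.+1 + ((char_poly A)`_k.+1)%:M.
Proof.
by rewrite -adj_coefX; apply/matrixP => i j; rewrite !mxE coefXM.
Qed.

(** The recursion adj_coef_pred propagates the vanishing of the coefficients of
    large degree down to the degree n, as det (X - A) has degree n. *)
Lemma adj_coef_large k : (n <= k)%N -> adj_coef k = 0.
Proof.
pose K := (\max_i \max_j size (\adj (char_poly_mx A) i j))%N.
have big k' : (K <= k')%N -> adj_coef k' = 0.
  move=> Kk; apply/matrixP => i j; rewrite /adj_coef mxE [RHS]mxE.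
  rewrite nth_default // (leq_trans _ Kk) // (leq_trans _ (leq_bigmax i)) //.
  exact: (leq_bigmax (F := fun j => size (\adj (char_poly_mx A) i j))).
move: (leq_addl k K); move: {2}K => d; elim: d k => [|d IH] k Kk nk.
  by apply: big; rewrite addn0 in Kk.
rewrite adj_coef_pred (IH k.+1) ?addSnnS ?(leq_trans nk) // mulmx0 add0r.
by rewrite nth_default ?size_char_poly // raddf0.
Qed.

End AdjCoef.

(** With B_(n+1) = 1 and B_n = A - Tr A, the recursion for the trace at the
    degree n reads n c = Tr (A^2) - (Tr A)^2 + (n + 2) c. *)
Lemma char_poly_coef2 (R : comNzRingType) n (A : 'M[R]_n.+2) :
  (char_poly A)`_n *+ 2 = \tr A ^+ 2 - \tr (A *m A).
Proof.
have cn2 : (char_poly A)`_n.+2 = 1.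
  by have := monicP (char_poly_monic A); rewrite lead_coefE size_char_poly.
have B1 : adj_coef A n.+1 = 1%:M.
  by rewrite adj_coef_pred adj_coef_large // mulmx0 add0r cn2.
have := tr_mul_adj_coef A n.
rewrite adj_coef_pred B1 mulmx1 mulmxDr mxtraceD mul_mx_scalar mxtraceZ.
rewrite (char_poly_trace A (ltn0Sn n.+1)); move: (char_poly A)`_n => c.
have -> : c *+ 2 = c *+ n.+2 - c *+ n.
  by rewrite -(addn2 n) -mulrnBr ?addKn ?leq_addr.
by move=> ->; ring.
Qed.

Section PontryaginTrace.
Variables (R : realType) (m : nat).
Implicit Types A B C : 'M[R]_m.

Lemma pontryagin_coef2 A :
  pontryagin_coef 2 A = (8 * pi ^+ 2)^-1 * (\tr A ^+ 2 - \tr (A *m A)).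
Proof.
have pi0 : (pi : R) != 0 by rewrite gt_eqF // pi_gt0.
have n2 : (2 : R) != 0 by rewrite pnatr_eq0.
(* For m < 2 the coefficient is 0, and so is the difference of the traces. *)
rewrite /pontryagin_coef; case: m A => [|[|n]] A /=.
- by rewrite /mxtrace !big_ord0 expr0n subr0 mulr0.
- by rewrite /mxtrace !big_ord1 mxE big_ord1 expr2 subrr mulr0.
rewrite !subSS subn0; apply: (mulIf n2); rewrite mulr_natr char_poly_coef2.
rewrite mxtraceZ -scalemxAl -scalemxAr scalerA mxtraceZ.
by move: (pi : R) pi0 => w w0; field.
Qed.

Lemma sum_set2 (V : zmodType) (F : {set 'I_2} -> V) :
  \sum_S F S = F finset.set0 + F [set ord0]%SET + F [set ord_max]%SET
    + F [set: 'I_2]%SET.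
Proof.
have inS (S : {set 'I_2}) :
    S = [set i | if val i == 0%N then ord0 \in S else ord_max \in S]%SET.
  apply/setP => i; rewrite inE.
  by case: i => [[|[|//]] ?] /=; congr (_ \in S); apply: val_inj.
rewrite (bigD1 finset.set0) //= (bigD1 [set ord0]%SET) /=; last first.
  by apply/eqP => /setP/(_ ord0); rewrite !inE eqxx.
rewrite (bigD1 [set ord_max]%SET) /=; last first.
  by apply/andP; split; apply/eqP => /setP/(_ ord_max); rewrite !inE eqxx.
rewrite (bigD1 [set: 'I_2]%SET) /=; last first.
  by rewrite -!andbA; apply/and3P; split; apply/eqP => /setP e;
    [have := e ord0| have := e ord_max|have := e ord0]; rewrite !inE.
rewrite big1 ?addr0 ?addrA // => S; rewrite -!andbA.
move=> /and4P[/eqP h0 /eqP h1 /eqP h2 /eqP h3].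
exfalso; case e0: (ord0 \in S); case e1 : (ord_max \in S);
  [case: h3|case: h1|case: h2|case: h0]; apply/setP => i;
  by rewrite [S]inS !inE e0 e1; case: i => [[|[|//]] ?].
Qed.

Lemma p1E A B :
  p1 A B = (8 * pi ^+ 2)^-1 * (\tr A * \tr B - \tr (A *m B)).
Proof.
have n2 : (2 : R) != 0 by rewrite pnatr_eq0.
rewrite /p1 /pontryagin /polarization sum_set2 !pontryagin_coef2.
have -> : \sum_(i in [set: 'I_2]%SET) tnth [tuple A; B] i = A + B.
  by rewrite big_mkcond /= big_ord_recl big_ord1 !inE !(tnth_nth 0).
rewrite cards0 !cards1 cardsT card_ord big_set0 !big_set1 !(tnth_nth 0) /=.
rewrite !mulmxDl !mulmxDr !mxtraceD mul0mx mxtrace0 [\tr (B *m A)]mxtrace_mulC.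
rewrite (_ : 2`! = 2%N) // !subSS !subn0 /=.
by move: (8 * _)^-1 => c; field.
Qed.

Lemma p1C A B : p1 A B = p1 B A.
Proof. by rewrite !p1E mxtrace_mulC [_ * \tr A]mulrC. Qed.

Lemma p1Nl A B : p1 (- A) B = - p1 A B.
Proof. by rewrite !p1E mulNmx !raddfN mulNr -opprD mulrN. Qed.

Lemma p1_0l A : p1 0 A = 0.
Proof. by rewrite p1E mul0mx !mxtrace0 mul0r subrr mulr0. Qed.

Lemma p1_0r A : p1 A 0 = 0.
Proof. by rewrite p1C p1_0l. Qed.

Lemma p1_bracket a A B C :
  p1 A (a *: bracket B C) =
  (8 * pi ^+ 2)^-1 * a * (\tr (A *m C *m B) - \tr (A *m B *m C)).
Proof.
rewrite p1E -scalemxAr !mxtraceZ /bracket mulmxBr !raddfB /=.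
by rewrite [\tr (C *m B)]mxtrace_mulC subrr !mulr0 sub0r -!mulmxA; ring.
Qed.

Lemma mxtrace_mul3_cyclic A B C :
  [/\ \tr (B *m C *m A) = \tr (A *m B *m C),
      \tr (C *m A *m B) = \tr (A *m B *m C),
      \tr (C *m B *m A) = \tr (A *m C *m B)
    & \tr (B *m A *m C) = \tr (A *m C *m B)].
Proof.
by split; rewrite ?[\tr (A *m _ *m _)]mxtrace_mulC ?mulmxA //;
  rewrite mxtrace_mulC mulmxA.
Qed.

End PontryaginTrace.

(** * Alternating sums over small symmetric groups *)

Lemma lift_perm_bij n :
  bijective (fun js : 'I_n.+1 * 'S_n => lift_perm ord0 js.1 js.2).
Proof.
apply: inj_card_bij => [[j s] [k t] /= e|]; last first.
  by rewrite card_prod !card_Sn card_ord factS.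
have ejk : j = k by rewrite -(lift_perm_id ord0 j s) e lift_perm_id.
congr (_, _) => //; apply/permP => i; apply: (@lift_inj _ j).
by rewrite -(lift_perm_lift ord0) e ejk lift_perm_lift.
Qed.

Section AltSum.
Variables (R : pzRingType) (W : lmodType R).

(** The expansion along the first row, for an arbitrary function in place of a
    product of matrix entries. *)
Lemma alt_sum_rec n (G : 'I_n.+1 -> ('I_n -> 'I_n.+1) -> W) :
  \sum_(s : 'S_n.+1) (-1) ^+ odd_perm s *: G (s ord0) (fun i => s (lift ord0 i))
  = \sum_(j < n.+1) (-1) ^+ j *:
      \sum_(s : 'S_n) (-1) ^+ odd_perm s *: G j (fun i => lift j (s i)).
Proof.
rewrite (reindex _ (onW_bij _ (lift_perm_bij n))) /=.
under [RHS]eq_bigr => j _ do rewrite scaler_sumr.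
rewrite pair_big; apply: eq_bigr => -[j s] _ /=.
rewrite scalerA odd_lift_perm /= signr_addb signr_odd lift_perm_id.
by congr (_ *: G _ _); apply/funext => i; rewrite lift_perm_lift.
Qed.

Lemma alt_sum_S0 (F : 'S_0 -> W) :
  \sum_(s : 'S_0) (-1) ^+ odd_perm s *: F s = F 1%g.
Proof.
rewrite (bigD1 1%g) //= big1 ?odd_perm1 ?scale1r ?addr0 // => s.
by case/eqP; apply/permP => -[].
Qed.

Lemma alt_sum_S1 (F : 'I_1 -> W) :
  \sum_(s : 'S_1) (-1) ^+ odd_perm s *: F (s ord0) = F ord0.
Proof.
by rewrite (alt_sum_rec (fun i _ => F i)) big_ord1 alt_sum_S0 scale1r.
Qed.

Lemma alt_sum_S2 (F : nat -> nat -> W) :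
  \sum_(s : 'S_2) (-1) ^+ odd_perm s *: F (s ord0) (s (lift ord0 ord0))
  = F 0%N 1%N - F 1%N 0%N.
Proof.
rewrite (alt_sum_rec (fun i f => F i (f ord0))) big_ord_recl big_ord1.
rewrite /= !(alt_sum_S1 (fun i => F _ (bump _ i))) /bump /=.
by rewrite !scale1r scaleN1r.
Qed.

Lemma alt_sum_S3 (F : nat -> nat -> nat -> W) :
  \sum_(s : 'S_3) (-1) ^+ odd_perm s *:
    F (s ord0) (s (lift ord0 ord0)) (s (lift ord0 (lift ord0 ord0)))
  = F 0%N 1%N 2%N - F 0%N 2%N 1%N - (F 1%N 0%N 2%N - F 1%N 2%N 0%N)
    + (F 2%N 0%N 1%N - F 2%N 1%N 0%N).
Proof.
rewrite (alt_sum_rec (fun i f => F i (f ord0) (f (lift ord0 ord0)))).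
rewrite !big_ord_recl big_ord0.
rewrite /= !(alt_sum_S2 (fun i j => F _ (bump _ i) (bump _ j))) /= /bump /=.
by rewrite !scale1r scaleN1r expr2 mulN1r opprK scale1r addr0 addrA.
Qed.

Lemma alt_sum_S4 (F : nat -> nat -> nat -> nat -> W) :
  \sum_(s : 'S_4) (-1) ^+ odd_perm s *:
    F (s ord0) (s (lift ord0 ord0)) (s (lift ord0 (lift ord0 ord0)))
      (s (lift ord0 (lift ord0 (lift ord0 ord0))))
  = \sum_(j < 4) (-1) ^+ j *: (
      let G a b c : W := F j (bump j a) (bump j b) (bump j c) in
      G 0%N 1%N 2%N - G 0%N 2%N 1%N - (G 1%N 0%N 2%N - G 1%N 2%N 0%N)
      + (G 2%N 0%N 1%N - G 2%N 1%N 0%N)).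
Proof.
rewrite (alt_sum_rec (fun i f => F i (f ord0) (f (lift ord0 ord0))
  (f (lift ord0 (lift ord0 ord0))))).
apply: eq_bigr => j _; congr (_ *: _).
exact: (alt_sum_S3 (fun a b c => F j (bump j a) (bump j b) (bump j c))).
Qed.
End AltSum.

(** The types of the forms do not record multilinearity, so these lemmas take
    the functions f and g of separate vectors that the forms are given by. *)
Section Wedges.
Variables (R : realType) (V : normedModType R).

Lemma wedge11 (W1 W2 W : normedModType R) (b : W1 -> W2 -> W)
    (phi : Defs.form V W1 1) (psi : Defs.form V W2 1)
    (f : V -> W1) (g : V -> W2) p v :
  (forall v, phi p v = f (v ord0)) -> (forall v, psi p v = g (v ord0)) ->
  wedge b phi psi p v =
    b (f (v ord0)) (g (v ord_max)) - b (f (v ord_max)) (g (v ord0)).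
Proof.
move=> hf hg; rewrite /wedge (_ : 1`! = 1%N) // mulr1 invr1 scale1r.
pose v' k : V := v (inord k).
have v'E i : v i = v' i by rewrite /v' inord_val.
rewrite !v'E /= -(alt_sum_S2 (fun i j => b (f (v' i)) (g (v' j)))).
apply: eq_bigr => s _; rewrite hf hg !v'E.
by congr (_ *: b (f (v' (s _))) (g (v' (s _)))); apply: val_inj.
Qed.

Lemma wedge21 (W1 W2 : normedModType R) (b : W1 -> W2 -> R)
    (phi : Defs.form V W1 2) (psi : Defs.form V W2 1)
    (f : V -> V -> W1) (g : V -> W2) p (v : 'I_3 -> V) :
  (forall v, phi p v = f (v ord0) (v ord_max)) ->
  (forall v, psi p v = g (v ord0)) ->
  let v' k := v (inord k) in
  wedge b phi psi p v = 2^-1 *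
    (b (f (v' 0) (v' 1)) (g (v' 2)) - b (f (v' 0) (v' 2)) (g (v' 1))
     - (b (f (v' 1) (v' 0)) (g (v' 2)) - b (f (v' 1) (v' 2)) (g (v' 0)))
     + (b (f (v' 2) (v' 0)) (g (v' 1)) - b (f (v' 2) (v' 1)) (g (v' 0)))).
Proof.
move=> hf hg v'; rewrite /wedge (_ : 1`! = 1%N) // (_ : 2`! = 2%N) // mulr1.
have v'E i : v i = v' i by rewrite /v' inord_val.
congr (_ * _).
rewrite -(alt_sum_S3 (W := R^o) (fun i j k => b (f (v' i) (v' j)) (g (v' k)))).
apply: eq_bigr => s _; rewrite hf hg !v'E.
by congr (_ *: b (f (v' (s _)) (v' (s _))) (g (v' (s _)))); apply: val_inj.
Qed.

(** The eight permutations preserving a pairing of the four vectors contribute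
    equally, and the factor 1 / (2! 2!) of the wedge product leaves 2. *)
Lemma wedge22 (W : normedModType R) (b : W -> W -> R)
    (phi : Defs.form V W 2) (f : V -> V -> W) p (v : 'I_4 -> V) :
  (forall x y, b x y = b y x) -> (forall x y, b (- x) y = - b x y) ->
  (forall v, phi p v = f (v ord0) (v ord_max)) ->
  (forall x y, f y x = - f x y) ->
  let v' k := v (inord k) in
  wedge b phi phi p v = 2 *
    (b (f (v' 0) (v' 1)) (f (v' 2) (v' 3))
     - b (f (v' 0) (v' 2)) (f (v' 1) (v' 3))
     + b (f (v' 0) (v' 3)) (f (v' 1) (v' 2))).
Proof.
move=> bC bN hf fN v'; rewrite /wedge (_ : 2`! = 2%N) //.
have v'E i : v i = v' i by rewrite /v' inord_val.
have bNr x y : b x (- y) = - b x y by rewrite bC bN bC.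
pose F i j k l : R^o := b (f (v' i) (v' j)) (f (v' k) (v' l)).
transitivity ((2 * 2)^-1 * \sum_(s : 'S_4) ((-1) ^+ odd_perm s *:
   F (s ord0) (s (lift ord0 ord0)) (s (lift ord0 (lift ord0 ord0)))
     (s (lift ord0 (lift ord0 (lift ord0 ord0)))))).
  congr (_ * _); apply: eq_bigr => s _; rewrite !hf !v'E /F.
  by congr (_ *: b (f (v' (s _)) (v' (s _))) (f (v' (s _)) (v' (s _))));
    apply: val_inj.
rewrite (alt_sum_S4 F) !big_ord_recl big_ord0 /bump /= /F.
rewrite (fN (v' 0) (v' 1)) (fN (v' 0) (v' 2)) (fN (v' 0) (v' 3)).
rewrite (fN (v' 1) (v' 2)) (fN (v' 1) (v' 3)) (fN (v' 2) (v' 3)).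
rewrite !bN !bNr.
rewrite (bC (f (v' 2) (v' 3))) (bC (f (v' 1) (v' 3))).
by rewrite (bC (f (v' 1) (v' 2)) (f (v' 0) _)) /GRing.scale /=; field.
Qed.
End Wedges.

(** * Derivatives of matrix-valued maps *)

Section Calculus.
Variable R : realType.

Lemma cvg_growth_is_derive (V W : normedModType R) (f : V -> W) (p v : V)
    (w : W) :
  (fun h : R => h^-1 *: (f (h *: v + p) - f p)) @ 0^' --> w ->
  is_derive p v f w.
Proof.
by move=> fw; apply: DeriveDef; [apply/cvg_ex; exists w|exact: cvg_lim].
Qed.

Lemma is_derive_quadratic (V W : normedModType R) (f : V -> W) (p v : V)
    (w c : W) :
  (forall h : R, f (h *: v + p) = f p + h *: w + h ^+ 2 *: c) ->
  is_derive p v f w.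
Proof.
move=> fE; apply: cvg_growth_is_derive.
have : (fun h : R => w + h *: c) @ 0^' --> w.
  rewrite -[X in _ --> X]addr0; apply: cvgD; first exact: cvg_cst.
  rewrite -[X in _ --> X](scale0r c); apply: cvgZr_tmp.
  exact: cvg_within.
apply: cvg_trans; apply: near_eq_cvg; near=> h.
have h0 : h != 0 by near: h; exact: nbhs_dnbhs_neq.
rewrite fE [_ - f p]addrC -!addrA addKr scalerDr !scalerA mulVf // scale1r.
by rewrite expr2 mulrA mulVf // mul1r.
Unshelve. all: by end_near. Qed.

Lemma is_derive_linear (V1 V2 : normedModType R) (f : V1 -> V2) (a v : V1) :
  (forall (h : R), f (h *: v + a) = h *: f v + f a) -> is_derive a v f (f v).
Proof.
move=> fl; apply: (@is_derive_quadratic _ _ _ _ _ _ 0) => h.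
by rewrite fl scaler0 addr0 addrC.
Qed.

Lemma is_derive_line (V W : normedModType R) (f : V -> W) (p v : V) (w : W) :
  is_derive (0 : R) (1 : R) (fun h : R => f (h *: v + p)) w ->
  is_derive p v f w.
Proof.
move=> [/cvg_ex[l fl] fw]; apply: cvg_growth_is_derive.
have <- : l = w by rewrite -fw; apply/esym/cvg_lim.
apply: cvg_trans fl; apply: near_eq_cvg; apply: nearW => h /=.
by rewrite addr0 scale0r add0r [_ *: 1]mulr1.
Qed.

Lemma is_derive_mxP (V : normedModType R) n m (A : V -> 'M[R]_(n, m)) t v dA :
  is_derive t v A dA <-> forall i j, is_derive t v (fun x => A x i j) (dA i j).
Proof.
split=> [[dvA <-] i j|h].
  rewrite derive_mx // mxE; apply: derivableP.
  exact: ((derivable_mxP A t v).1 dvA).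
have dvA : derivable A t v by apply/derivable_mxP => i j; have [] := h i j.
apply: DeriveDef => //; rewrite derive_mx //; apply/matrixP => i j.
by rewrite mxE derive_val.
Qed.

Lemma is_derive_mulmx (V : normedModType R) n m k
    (A : V -> 'M[R]_(n, m)) (B : V -> 'M[R]_(m, k)) t v dA dB :
  is_derive t v A dA -> is_derive t v B dB ->
  is_derive t v (fun x => A x *m B x) (A t *m dB + dA *m B t).
Proof.
move=> /is_derive_mxP hA /is_derive_mxP hB; apply/is_derive_mxP => i j.
rewrite [X in is_derive _ _ X _](_ : _ =
    \sum_l (fun x => A x i l) * (fun x => B x l j)).
  rewrite !mxE -big_split /=; apply: is_derive_sum => l.
  by apply: is_derive_eq; rewrite [dA i l * _]mulrC.
by apply/funext => x; rewrite mxE fct_sumE.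
Qed.

Lemma is_derive_scalemx (V : normedModType R) n m
    (a : V -> R) (B : V -> 'M[R]_(n, m)) t v da dB :
  is_derive t v a da -> is_derive t v B dB ->
  is_derive t v (fun x => a x *: B x) (a t *: dB + da *: B t).
Proof.
move=> ha /is_derive_mxP hB; apply/is_derive_mxP => i j.
rewrite [X in is_derive _ _ X _](_ : _ = a * (fun x => B x i j)).
  by apply: is_derive_eq; rewrite !mxE [da * _]mulrC.
by apply/funext => x; rewrite mxE.
Qed.

Lemma derivable_det (V : normedModType R) n (A : V -> 'M[R]_n) t v :
  derivable A t v -> derivable (fun x => \det (A x)) t v.
Proof.
move=> /derivable_mxP dA.
rewrite [X in derivable X](_ : _ = \sum_(s : 'S_n)
    (cst ((-1) ^+ s) * \prod_i (fun x => A x i (s i)))).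
  elim/big_ind: _ => [|f g df dg|s _].
  - exact: derivable_cst.
  - exact: derivableD.
  apply: derivableM; first exact: derivable_cst.
  elim/big_ind: _ => [|f g df dg|i _]; last exact: dA.
  - exact: derivable_cst.
  - exact: derivableM.
apply/funext => x; rewrite /determinant fct_sumE; apply: eq_bigr => s _.
rewrite fctE; congr (_ * _).
by elim/big_ind2: _ => // f a g b -> ->.
Qed.

(** By Cramer's rule the entries are quotients of determinants. *)
Lemma derivable_invmx (V : normedModType R) n (A : V -> 'M[R]_n) t v :
  derivable A t v -> {near t, forall x, A x \in unitmx} ->
  derivable (fun x => invmx (A x)) t v.
Proof.
move=> dA uA.
apply: (@near_eq_derivable _ _ _ (fun x => (\det (A x))^-1 *: \adj (A x))).
  near=> x; rewrite /invmx ifT //; near: x; exact: uA.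
apply/derivable_mxP => i j.
rewrite [X in derivable X](_ : _ =
    (fun x => (\det (A x))^-1) * (fun x => cofactor (A x) j i)); last first.
  by apply/funext => x; rewrite !mxE.
apply: derivableM.
  apply: derivableV; last exact: derivable_det.
  by rewrite -unitfE -unitmxE; exact: nbhs_singleton uA.
apply: (@derivableM _ _ (cst _) (fun x => \det _)).
  exact: derivable_cst.
apply: derivable_det; apply/derivable_mxP => k l.
under eq_fun do rewrite !mxE.
exact: ((derivable_mxP A t v).1 dA).
Unshelve. all: by end_near. Qed.

(** Once the inverse is known to be derivable, its derivative is obtained from
    that of the constant function A A^-1. *)
Lemma is_derive_invmx n (A : R -> 'M[R]_n) t v dA :
  is_derive t v A dA -> {near t, forall x, A x \in unitmx} ->
  is_derive t v (fun x => invmx (A x)) (- (invmx (A t) *m dA *m invmx (A t))).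
Proof.
move=> hA uA.
have dI : derivable (fun x => invmx (A x)) t v.
  by apply: derivable_invmx => //; have [] := hA.
have hI := derivableP dI; apply: is_derive_eq => //.
set dB := 'D_v _ t in hI *.
have uAt : A t \in unitmx by exact: nbhs_singleton uA.
have h1 : is_derive t v (fun x => A x *m invmx (A x)) 0.
  apply: (@near_eq_is_derive _ _ _ (cst (1%:M : 'M[R]_n))).
  by near=> x; rewrite mulmxV //; near: x; exact: uA.
have h2 := is_derive_mulmx hA hI.
have e : A t *m dB + dA *m invmx (A t) = 0.
  by rewrite -(@derive_val _ _ _ _ _ _ _ h1) (@derive_val _ _ _ _ _ _ _ h2).
rewrite -(mulKmx uAt dB); move/eqP: e; rewrite addr_eq0 => /eqP ->.
by rewrite mulmxN mulmxA.
Unshelve. all: by end_near. Qed.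

Lemma near_unitmx n (A : R -> 'M[R]_n) (t : R) :
  derivable A t 1 -> A t \in unitmx -> {near t, forall x, A x \in unitmx}.
Proof.
move=> dA uA.
have /derivable1_diffP/differentiable_continuous cd := derivable_det dA.
near=> x; rewrite unitmxE unitfE; near: x.
apply: (cd [set y | y != 0]); apply: open_nbhs_nbhs; split.
  exact: open_neq.
by rewrite /= -unitfE -unitmxE.
Unshelve. all: by end_near. Qed.

End Calculus.

(** * The covering of the rotation group *)

Section SpinCover.
Variables (R : realType) (m : nat).
Implicit Types (p q w : cliff R m).

(** The bilinear map whose restriction to the diagonal is spin_cover. *)
Definition polar_cover p q : 'M[R]_m :=
  \matrix_(i, j) clcoord [set i]%SET (p * clbasis R [set j]%SET * clrev q).

Lemma polar_coverDl p q w :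
  polar_cover (p + q) w = polar_cover p w + polar_cover q w.
Proof. by apply/matrixP => i j; rewrite !mxE !mulrDl clcoordD. Qed.

Lemma polar_coverDr p q w :
  polar_cover w (p + q) = polar_cover w p + polar_cover w q.
Proof. by apply/matrixP => i j; rewrite !mxE clrevD !mulrDr clcoordD. Qed.

Lemma polar_coverZl a p q : polar_cover (a *: p) q = a *: polar_cover p q.
Proof. by apply/matrixP => i j; rewrite !mxE -!scalerAl clcoordZ. Qed.

Lemma polar_coverZr a p q : polar_cover p (a *: q) = a *: polar_cover p q.
Proof. by apply/matrixP => i j; rewrite !mxE clrevZ -!scalerAr clcoordZ. Qed.

(** The derivative of spin_cover at p in the direction w. *)
Definition cover_diff p w := polar_cover w p + polar_cover p w.

(** The second derivative of the quadratic map spin_cover is its polarization;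
    this symmetry is the equality of its mixed second derivatives. *)
Lemma cover_diffC p w : cover_diff p w = cover_diff w p.
Proof. exact: addrC. Qed.

Lemma cover_diff_line p w u (h : R) :
  cover_diff (h *: w + p) u = cover_diff p u + h *: cover_diff w u.
Proof.
rewrite /cover_diff !polar_coverDl !polar_coverDr !polar_coverZl !polar_coverZr.
by rewrite scalerDr addrACA addrC.
Qed.

Lemma spin_cover_line p w (h : R) :
  spin_cover (h *: w + p) =
  spin_cover p + h *: cover_diff p w + h ^+ 2 *: spin_cover w.
Proof.
have E q : spin_cover q = polar_cover q q by [].
rewrite !E /cover_diff !polar_coverDl !polar_coverDr.
rewrite !polar_coverZl !polar_coverZr scalerA -expr2 scalerDr.
by apply/matrixP => i j; rewrite !mxE; ring.
Qed.

Lemma is_derive_spin_cover p w :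
  is_derive p w (@spin_cover R m) (cover_diff p w).
Proof. exact: (is_derive_quadratic (spin_cover_line p w)). Qed.

(** A vector killed by spin_cover p satisfies p v p^-1 = 0, as conjugation by p
    is spin_cover p on vectors. *)
Lemma spin_cover_unit p : spin p -> spin_cover p \in unitmx.
Proof.
move=> sp; rewrite -unitmx_tr -row_free_unit; apply: inj_row_free => v v0.
have := spin_conj v sp; rewrite v0 => e.
have [_ pp] := spin_mulVr sp.
have {}e : clvec v = 0.
  have -> : clvec v = clrev p * (p * clvec v * clrev p) * p.
    by rewrite !mulrA pp mul1r -mulrA pp mulr1.
  by rewrite e /clvec big1 ?mulr0 ?mul0r // => i _; rewrite mxE scale0r.
apply/rowP => i; rewrite -clcoord_vec e mxE.
by rewrite /clcoord mxE.
Qed.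
End SpinCover.

(** * Curvature *)

Lemma dform1_is_derive (R : realType) (V W : normedModType R)
    (phi : Defs.form V W 1) (p : V) (v : 'I_2 -> V) a b :
  is_derive p (v ord0) (fun q => phi q (fun=> v ord_max)) a ->
  is_derive p (v ord_max) (fun q => phi q (fun=> v ord0)) b ->
  dform phi p v = a - b.
Proof.
move=> [_ <-] [_ <-]; rewrite /dform big_ord_recl big_ord1 scale1r scaleN1r.
have -> : lift ord0 ord0 = ord_max :> 'I_2 by apply: val_inj.
have -> : (fun j : 'I_1 => v (lift ord0 j)) = (fun=> v ord_max).
  by apply/funext => j; congr v; apply: val_inj; case: j => -[].
have -> // : (fun j : 'I_1 => v (lift ord_max j)) = (fun=> v ord0).
by apply/funext => j; congr v; apply: val_inj; case: j => -[].
Qed.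

Section Kappa.
Variables (R : realType) (m n : nat).
Local Notation V := (EGspace R m n).
Local Notation factor j p := (row j p : cliff R m).
Implicit Types (p u w : V) (t : 'rV[R]_n.+1) (x y : ('rV[R]_n.+1 * V)%type).

Definition omega_at (j : 'I_n.+1) p u : 'M[R]_m :=
  invmx (spin_cover (factor j p)) *m cover_diff (factor j p) (row j u).

Lemma omegaE j p (v : 'I_1 -> V) : omega R m n j p v = omega_at j p (v ord0).
Proof.
rewrite /omega /pullback /maurer_cartan /omega_at.
have hr : is_derive p (v ord0) (fun q : V => factor j q) (row j (v ord0)).
  by apply: is_derive_linear => h; rewrite linearP.
rewrite (@derive_val _ _ _ _ _ _ _ hr).
by rewrite (@derive_val _ _ _ _ _ _ _ (is_derive_spin_cover _ _)).
Qed.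

Lemma omega_hatE x (v : 'I_1 -> 'rV[R]_n.+1 * V) :
  omega_hat R m n x v = \sum_j x.1 ord0 j *: omega_at j x.2 (v ord0).2.
Proof.
apply: eq_bigr => j _; rewrite /pullback omegaE.
have hs : is_derive x (v ord0) (@snd _ V) (v ord0).2 by exact: is_derive_linear.
by rewrite (@derive_val _ _ _ _ _ _ _ hs).
Qed.

Lemma is_derive_omega_at j p w u : spin (factor j p) ->
  is_derive (0 : R) (1 : R) (fun h : R => omega_at j (h *: w + p) u)
    (invmx (spin_cover (factor j p)) *m cover_diff (factor j w) (row j u)
     - omega_at j p w *m omega_at j p u).
Proof.
move=> sp; rewrite /omega_at.
pose q (h : R) : cliff R m := h *: factor j w + factor j p.
have qE h : row j (h *: w + p) = q h by rewrite linearP.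
have q0 : q 0 = row j p by rewrite /q scale0r add0r.
under eq_fun do rewrite qE.
have hA : is_derive (0 : R) (1 : R) (fun h => spin_cover (q h))
    (cover_diff (factor j p) (row j w)).
  apply: (is_derive_quadratic (c := spin_cover (factor j w))) => h.
  by rewrite q0 addr0 [h *: 1]mulr1 /q spin_cover_line.
have hB : is_derive (0 : R) (1 : R) (fun h => cover_diff (q h) (row j u))
    (cover_diff (factor j w) (row j u)).
  apply: (is_derive_quadratic (c := 0)) => h.
  by rewrite q0 addr0 [h *: 1]mulr1 /q cover_diff_line scaler0 addr0.
have dA : derivable (fun h => spin_cover (q h)) 0 1 by case: hA.
have uA := near_unitmx dA; rewrite q0 in uA.
have hI := is_derive_invmx hA (uA (spin_cover_unit sp)).
apply: is_derive_eq (is_derive_mulmx hI hB) _.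
by rewrite q0 mulNmx !mulmxA.
Qed.

Lemma is_derive_omega_hat t p x y : EG R m n p ->
  is_derive (t, p) x (fun q => omega_hat R m n q (fun=> y))
    (\sum_j (x.1 ord0 j *: omega_at j p y.2 + t ord0 j *:
      (invmx (spin_cover (factor j p)) *m cover_diff (factor j x.2) (row j y.2)
       - omega_at j p x.2 *m omega_at j p y.2))).
Proof.
move=> sp; apply: is_derive_line => /=.
rewrite [X in is_derive _ _ X _](_ : _ = \sum_j (fun h : R =>
   (h *: x.1 + t) ord0 j *: omega_at j (h *: x.2 + p) y.2)); last first.
  by apply/funext => h; rewrite omega_hatE fct_sumE.
apply: is_derive_sum => j.
have ha : is_derive (0 : R) (1 : R) (fun h : R => (h *: x.1 + t) ord0 j)
    (x.1 ord0 j).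
  apply: (is_derive_quadratic (c := 0)) => h.
  by rewrite !mxE [h *: 1]mulr1 scaler0 mul0r !addr0 add0r addrC.
have hO := is_derive_omega_at x.2 y.2 (sp j).
apply: is_derive_eq (is_derive_scalemx ha hO) _.
by rewrite !mxE mul0r !scale0r !add0r addrC.
Qed.

(** The curvature at (t, p): the terms dt_j /\ omega_j, then sum_j t_j d omega_j
    by the Maurer-Cartan equation, then the bracket of the convex combination
    with itself. *)
Definition kappa_at t p x y : 'M[R]_m :=
  \sum_j (x.1 ord0 j *: omega_at j p y.2 - y.1 ord0 j *: omega_at j p x.2)
  - \sum_j t ord0 j *: bracket (omega_at j p x.2) (omega_at j p y.2)
  + bracket (\sum_j t ord0 j *: omega_at j p x.2)
            (\sum_j t ord0 j *: omega_at j p y.2).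

Lemma bracketN (A B : 'M[R]_m) : bracket B A = - bracket A B.
Proof. by rewrite /bracket opprB. Qed.

Lemma bracket0l (A : 'M[R]_m) : bracket 0 A = 0.
Proof. by rewrite /bracket mul0mx mulmx0 subrr. Qed.

Lemma kappa_atN t p x y : kappa_at t p y x = - kappa_at t p x y.
Proof.
have opp (a b c a' b' c' : 'M[R]_m) :
    a' = - a -> b' = - b -> c' = - c -> a' - b' + c' = - (a - b + c).
  by move=> -> -> ->; rewrite !opprD.
apply: opp; last exact: bracketN.
  by rewrite -sumrN; apply: eq_bigr => j _; rewrite opprB.
by rewrite -sumrN; apply: eq_bigr => j _; rewrite bracketN scalerN.
Qed.

(** In the exterior derivative, the terms with pi^-1 d d pi cancel by symmetry
    and the terms from d (pi^-1) combine to - [omega_j /\ omega_j] / 2. *)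
Lemma kappaE t p (v : 'I_2 -> 'rV[R]_n.+1 * V) : EG R m n p ->
  kappa R m n (t, p) v = kappa_at t p (v ord0) (v ord_max).
Proof.
move=> sp; rewrite /kappa /kappa_at; congr (_ + _); last first.
  rewrite (wedge11 _ (f := fun x => \sum_j t ord0 j *: omega_at j p x.2)
    (g := fun x => \sum_j t ord0 j *: omega_at j p x.2)); last 2 first.
  - exact: omega_hatE.
  - exact: omega_hatE.
  rewrite (bracketN (\sum_j t ord0 j *: omega_at j p (v ord0).2)) opprK -mulr2n.
  rewrite -[bracket _ _ *+ 2]scaler_nat.
  by rewrite scalerA mulVf ?scale1r // pnatr_eq0.
rewrite (dform1_is_derive (is_derive_omega_hat t (v ord0) (v ord_max) sp)
  (is_derive_omega_hat t (v ord_max) (v ord0) sp)).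
rewrite -!sumrB; apply: eq_bigr => j _.
rewrite [X in _ *m X]cover_diffC /bracket.
set a := _ *m cover_diff _ _.
set X := omega_at _ _ _; set Y := omega_at _ _ _.
by apply/matrixP => k l; rewrite !mxE; ring.
Qed.

Definition omega_bar_at (i : 'I_n.+1) p u := omega_at i p u - omega_at ord0 p u.

Lemma omega_barE i p (v : 'I_1 -> V) :
  omega_bar R m n i p v = omega_bar_at i p (v ord0).
Proof. by rewrite /omega_bar !omegaE. Qed.

Lemma omega_at0 j p : omega_at j p 0 = 0.
Proof.
rewrite /omega_at row0 /cover_diff -(scale0r (0 : cliff R m)).
by rewrite polar_coverZl polar_coverZr !scale0r addr0 mulmx0.
Qed.

(** A coordinate field moves weight from the vertex 0 to another vertex. *)
Lemma sum_partial (i : 'I_n) p u :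
  \sum_j partial R i ord0 j *: omega_at j p u = omega_bar_at (lift ord0 i) p u.
Proof.
rewrite big_ord_recl (bigD1 i) //= !mxE !eqxx /= big1 => [|j ji].
  by rewrite addr0 sub0r subr0 scaleN1r scale1r addrC.
by rewrite !mxE eqxx (inj_eq lift_inj) (negbTE ji) subrr scale0r.
Qed.

Lemma kappa_at_verticall t p (x : 'rV[R]_n.+1) (y : 'rV[R]_n.+1 * V) :
  kappa_at t p (x, 0) y = \sum_j x ord0 j *: omega_at j p y.2.
Proof.
rewrite /kappa_at [in X in _ + X]big1 => [|j _]; last first.
  by rewrite omega_at0 scaler0.
rewrite bracket0l addr0 [X in _ - X]big1 => [|j _]; last first.
  by rewrite omega_at0 bracket0l scaler0.
by rewrite subr0; apply: eq_bigr => j _; rewrite omega_at0 scaler0 subr0.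
Qed.

Lemma kappa_at_vertical t p (x y : 'rV[R]_n.+1) :
  kappa_at t p (x, 0) (y, 0) = 0.
Proof.
by rewrite kappa_at_verticall big1 // => j _; rewrite omega_at0 scaler0.
Qed.

Lemma kappa_at_mixed t p (i : 'I_n) u :
  kappa_at t p (partial R i, 0) (0, u) = omega_bar_at (lift ord0 i) p u.
Proof. by rewrite kappa_at_verticall sum_partial. Qed.

Lemma kappa_at_horizontal t p u w : kappa_at t p (0, u) (0, w) =
  bracket (\sum_j t ord0 j *: omega_at j p u)
          (\sum_j t ord0 j *: omega_at j p w)
  - \sum_j t ord0 j *: bracket (omega_at j p u) (omega_at j p w).
Proof.
rewrite /kappa_at /= big1 ?add0r 1?addrC // => j _.
by rewrite mxE !scale0r subrr.
Qed.
End Kappa.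

Lemma row_mx_head (R : pzRingType) n (x : R) (t : 'rV[R]_n) :
  (row_mx (x%:M : 'rV_1) t : 'rV_n.+1) ord0 ord0 = x.
Proof.
rewrite (_ : ord0 = @lshift 1 n ord0) ?(@row_mxEl _ _ 1 n) ?mxE ?eqxx //.
exact: val_inj.
Qed.

Lemma row_mx_tail (R : pzRingType) n (x : R) (t : 'rV[R]_n) i :
  (row_mx (x%:M : 'rV_1) t : 'rV_n.+1) ord0 (lift ord0 i) = t ord0 i.
Proof.
rewrite (_ : lift ord0 i = @rshift 1 n i) ?(@row_mxEr _ _ 1 n) //.
exact: val_inj.
Qed.

Lemma kappa_at_horizontal0 (R : realType) m (p u w : EGspace R m 0)
    (t : 'rV[R]_0) :
  kappa_at (barycentric t) p (0, u) (0, w) = 0.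
Proof.
rewrite kappa_at_horizontal !big_ord1.
have -> : barycentric t ord0 ord0 = 1 by rewrite row_mx_head big_ord0 subr0.
by rewrite !scale1r subrr.
Qed.

(** With omega_1 = omega_0 + bar omega_1, the curvature of the combination
    omega_0 + s bar omega_1 is quadratic in s and vanishes at s = 0 and s = 1,
    where the connection is flat. *)
Lemma kappa_at_horizontal1 (R : realType) m (p u w : EGspace R m 1)
    (t : 'rV[R]_1) :
  let s := t ord0 ord0 in
  kappa_at (barycentric t) p (0, u) (0, w) =
  (s ^+ 2 - s) *:
  bracket (omega_bar_at ord_max p u) (omega_bar_at ord_max p w).
Proof.
have sum2 (F : 'I_2 -> 'M[R]_m) : \sum_j F j = F ord0 + F ord_max.
  by rewrite big_ord_recl big_ord1; congr (_ + F _); apply: val_inj.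
move=> s; rewrite kappa_at_horizontal !sum2.
have -> : barycentric t ord0 ord0 = 1 - s by rewrite row_mx_head big_ord1.
have -> : barycentric t ord0 ord_max = s.
  rewrite (_ : ord_max = lift ord0 (ord0 : 'I_1)) ?row_mx_tail //.
  exact: val_inj.
rewrite /omega_bar_at; move: (omega_at ord0 p u) (omega_at ord_max p u) => A B.
move: (omega_at ord0 p w) (omega_at ord_max p w) => C D.
rewrite /bracket !(mulmxDl, mulmxDr, mulmxN, mulNmx) -!scalemxAl -!scalemxAr.
by apply/matrixP => i j; rewrite !mxE; ring.
Qed.

(** * Fibre integration *)

Section Integrals.
Variable R : realType.
Local Notation mu := (@lebesgue_measure R).

Lemma Rintegral_indic_horner (a b : R) (q : {poly R}) : a <= b ->
  Rintegral mu setT (fun x => \1_`[a, b] x * (q^`()).[x]) = q.[b] - q.[a].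
Proof.
rewrite le_eqVlt => /predU1P[<-|ab].
  rewrite subrr (_ : (fun x => _) = (fun x => (q^`()).[x]) \_ `[a, a]).
    by rewrite -Rintegral_mkcond set_itv1 Rintegral_set1.
  apply/funext => x; rewrite patchE indicE.
  by case: ifP => _; rewrite ?mul1r ?mul0r.
rewrite (_ : (fun x => _) = (fun x => (q^`()).[x]) \_ `[a, b]).
  rewrite -Rintegral_mkcond /Rintegral (@continuous_FTC2 _ _ (horner q)) //.
  - by apply: continuous_subspaceT => x; exact: continuous_horner.
  - split.
    + by move=> x _; exact: derivable_horner.
    + by apply: cvg_at_right_filter; exact: continuous_horner.
    + by apply: cvg_at_left_filter; exact: continuous_horner.
  - by move=> x _; rewrite -derive.derivE.
apply/funext => x; rewrite patchE indicE.
by case: ifP => _; rewrite ?mul1r ?mul0r.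
Qed.

Lemma iter_integral_0 n : iter_integral (fun _ : 'rV[R]_n => 0) = 0.
Proof. by elim: n => [//|n /= ->]; rewrite Rintegral_cst // mul0r. Qed.

Lemma std_simplex_row_mx n (x : R) (t : 'rV[R]_n) :
  (row_mx (x%:M : 'rV_1) t : 'rV_n.+1) \in @std_simplex R n.+1 =
  [&& 0 <= x, [forall i, 0 <= t ord0 i] & x + \sum_i t ord0 i <= 1].
Proof.
set xt := row_mx _ _.
have sE : \sum_i xt ord0 i = x + \sum_i t ord0 i.
  rewrite big_ord_recl row_mx_head; congr (_ + _).
  by apply: eq_bigr => i _; rewrite row_mx_tail.
apply/idP/idP => [/set_mem[t0 t1]|/and3P[x0 /forallP t0 t1]].
  rewrite -sE t1 andbT; apply/andP; split.
    by have := t0 ord0; rewrite row_mx_head.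
  by apply/forallP => i; have := t0 (lift ord0 i); rewrite row_mx_tail.
apply/mem_set; split; last by rewrite sE.
move=> i; case: (unliftP ord0 i) => [j|] ->.
  by rewrite row_mx_tail.
by rewrite row_mx_head.
Qed.

Lemma iter_integral_simplex1 (q : {poly R}) :
  iter_integral (fun t : 'rV[R]_1 =>
    \1_(@std_simplex R 1) t * (q^`()).[t ord0 ord0]) = q.[1] - q.[0].
Proof.
rewrite -Rintegral_indic_horner //=; congr Rintegral; apply/funext => x.
rewrite indicE std_simplex_row_mx big_ord0 addr0 indicE mem_setE in_itv /=.
rewrite (_ : [forall i, _] = true); last by apply/forallP => -[].
by have -> : (row_mx (x%:M : 'rV_1) (0 : 'rV_0) : 'rV_1) ord0 ord0 = x;
  first exact: row_mx_head.
Qed.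

Lemma iter_integral_simplex2 (c : R) :
  iter_integral (fun t : 'rV[R]_2 => \1_(@std_simplex R 2) t * c) = c / 2.
Proof.
(* A primitive of c (1 - x), the integral over the slice above x. *)
pose r : {poly R} := c *: 'X - (c / 2) *: 'X ^+ 2.
rewrite [RHS](_ : _ = r.[1] - r.[0]); last first.
  by rewrite /r !(hornerD, hornerN, hornerZ, hornerX, hornerXn); field.
rewrite -Rintegral_indic_horner //; congr Rintegral; apply/funext => x.
rewrite /= indicE mem_setE in_itv /=.
have [x0|x0] /= := boolP (0 <= x); last first.
  rewrite mul0r; rewrite -[RHS](@iter_integral_0 1) /=; congr Rintegral.
  by apply/funext => y; rewrite indicE std_simplex_row_mx (negbTE x0) mul0r.
have [x1|x1] /= := boolP (x <= 1); last first.
  rewrite mul0r; rewrite -[RHS](@iter_integral_0 1) /=; congr Rintegral.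
  apply/funext => y; rewrite indicE std_simplex_row_mx x0 /=.
  rewrite big_ord1; case: forallP => [/(_ ord0) h|]; last by rewrite mul0r.
  move: h; rewrite row_mx_head => h.
  by rewrite (_ : _ <= 1 = false) ?mul0r //; apply/negbTE; move: x1; lra.
rewrite mul1r.
transitivity ((c *: 'X).[1 - x] - (c *: 'X : {poly R}).[0]); last first.
  rewrite /r !(poly.derivE, hornerD, hornerN, hornerZ, hornerX, hornerC).
  by rewrite mul1r mulr1 hornerX; field.
rewrite -Rintegral_indic_horner ?subr_ge0 //; congr Rintegral.
apply/funext => y; rewrite !(poly.derivE, hornerE) indicE std_simplex_row_mx.
rewrite x0 /= indicE mem_setE in_itv /= mulr1; congr ((nat_of_bool _)%:R * _).
rewrite big_ord1 row_mx_head.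
congr (_ && _); last by rewrite lerBrDl.
by apply/forallP/idP => [/(_ ord0)|h i]; rewrite ?ord1 row_mx_head.
Qed.
End Integrals.

Section FiberArg.
Variables (R : realType) (m n : nat).
Local Notation V := (EGspace R m n).
Implicit Types (p : V) (u : 'I_(4 - n) -> V).

(** The arguments supplied by the fibre integral: n vertical vectors, then 4 - n
    horizontal ones. *)
Definition fiber_arg u (i : 'I_4) : 'rV[R]_n.+1 * V :=
  if insub (val i) is Some j then (partial R (j : 'I_n), 0)
  else if insub (i - n)%N is Some l then (0, u l) else 0.

Lemma fiber_arg_vertical u (k : nat) (j : 'I_n) :
  (n <= 4)%N -> k = j :> nat -> fiber_arg u (inord k) = (partial R j, 0).
Proof.
move=> n4 ->; have j4 : (j < 4)%N := leq_trans (ltn_ord j) n4.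
by rewrite /fiber_arg /= inordK // valK.
Qed.

Lemma fiber_arg_horizontal u (k : nat) (l : 'I_(4 - n)) :
  (n <= 4)%N -> k = (n + l)%N :> nat -> fiber_arg u (inord k) = (0, u l).
Proof.
move=> n4 ->; have l4 : (n + l < 4)%N by rewrite -ltn_subRL.
rewrite /fiber_arg /= inordK // insubN ?ltnNge ?leq_addr // addKn.
by rewrite valK.
Qed.

Definition kappa_fiber t p u i j :=
  kappa_at t p (fiber_arg u (inord i)) (fiber_arg u (inord j)).

Lemma shulman_p1E p u : (n <= 4)%N -> EG R m n p ->
  shulman (@p1 R m) n p u = iter_integral (fun t => \1_(@std_simplex R n) t *
    let K := kappa_fiber (barycentric t) p u in
    (2 * (p1 (K 0 1) (K 2 3) - p1 (K 0 2) (K 1 3) + p1 (K 0 3) (K 1 2)))).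
Proof.
move=> n4 sp; rewrite /shulman /fiber_integral n4; congr iter_integral.
apply/funext => t; congr (_ * _).
apply: (@wedge22 _ _ _ (@p1 R m) (kappa R m n) (kappa_at (barycentric t) p)).
- exact: p1C.
- exact: p1Nl.
- by move=> v; exact: kappaE.
- by move=> x y; exact: kappa_atN.
Qed.

Lemma kappa_fiber_vertical t p u i j : (n <= 4)%N -> (i < n)%N -> (j < n)%N ->
  kappa_fiber t p u i j = 0.
Proof.
move=> n4 i_n j_n; rewrite /kappa_fiber.
rewrite (fiber_arg_vertical u n4 (_ : i = Ordinal i_n)) //.
by rewrite (fiber_arg_vertical u n4 (_ : j = Ordinal j_n)) // kappa_at_vertical.
Qed.

End FiberArg.

(** * The forms chi_n *)

Section Main.
Variables (R : realType) (m : nat).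

Lemma p1_square_eq0 (K : nat -> nat -> 'M[R]_m) :
  K 0%N 1%N = 0 -> K 0%N 2%N = 0 -> K 1%N 2%N = 0 ->
  2 * (p1 (K 0 1) (K 2 3) - p1 (K 0 2) (K 1 3) + p1 (K 0 3) (K 1 2)) = 0.
Proof. by move=> -> -> ->; rewrite !p1_0l p1_0r subrr addr0 mulr0. Qed.

(** The integrand for n = 1; the six cubic traces reduce to two by cyclicity,
    and each of the three pairings contributes their difference. *)
Lemma p1_square_horizontal (K : nat -> nat -> 'M[R]_m) (w : nat -> 'M[R]_m) a :
  (forall k, (k < 3)%N -> K 0%N k.+1 = w k) ->
  (forall j k, (j < 3)%N -> (k < 3)%N ->
    K j.+1 k.+1 = a *: bracket (w j) (w k)) ->
  2 * (p1 (K 0 1) (K 2 3) - p1 (K 0 2) (K 1 3) + p1 (K 0 3) (K 1 2)) =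
  - 6 * a * ((8 * pi ^+ 2)^-1 *
    (\tr (w 0%N *m w 1%N *m w 2%N) - \tr (w 0%N *m w 2%N *m w 1%N))).
Proof.
move=> K0 KS; rewrite !K0 // !KS // !p1_bracket.
move: (w 0%N) (w 1%N) (w 2%N) => A B C.
have [-> -> -> ->] := mxtrace_mul3_cyclic A B C.
by move: (8 * _)^-1 (\tr _) (\tr _) => c X Y; ring.
Qed.

Lemma shulman0 (p : EGspace R m 0) u :
  EG R m 0 p -> shulman (@p1 R m) 0 p u = 0.
Proof.
move=> sp; rewrite shulman_p1E //=.
pose K := kappa_fiber (barycentric 0) p u.
have z i j : (i < 4)%N -> (j < 4)%N -> K i j = 0.
  move=> i4 j4; rewrite /K /kappa_fiber.
  rewrite (fiber_arg_horizontal u (l := Ordinal i4)) //.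
  by rewrite (fiber_arg_horizontal u (l := Ordinal j4)) // kappa_at_horizontal0.
by rewrite [X in _ * X](p1_square_eq0 (K := K)) ?mulr0 ?z.
Qed.

Lemma shulman_ge3 n (p : EGspace R m n) u : (3 <= n)%N -> EG R m n p ->
  shulman (@p1 R m) n p u = 0.
Proof.
move=> n3 sp; case: (leqP n 4) => [n4|n4]; last first.
  by rewrite /shulman /fiber_integral leqNgt n4.
rewrite shulman_p1E // -[RHS](@iter_integral_0 R n); congr iter_integral.
have n2 := ltnW n3; have n1 := ltnW n2.
apply/funext => t; pose K := kappa_fiber (barycentric t) p u.
rewrite [X in _ * X](p1_square_eq0 (K := K)).
- exact: mulr0.
- exact: kappa_fiber_vertical.
- exact: kappa_fiber_vertical.
- exact: kappa_fiber_vertical.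
Qed.

Lemma shulman1 (p : EGspace R m 1) (u : 'I_3 -> EGspace R m 1) : EG R m 1 p ->
  let w k := omega_bar_at ord_max p (u (inord k)) in
  shulman (@p1 R m) 1 p u =
  (8 * pi ^+ 2)^-1 *
  (\tr (w 0%N *m w 1%N *m w 2%N) - \tr (w 0%N *m w 2%N *m w 1%N)).
Proof.
move=> sp w; rewrite shulman_p1E //.
have l0 : lift ord0 ord0 = ord_max :> 'I_2 by apply: val_inj.
have a0 : fiber_arg (n := 1) u (inord 0) = (partial R (ord0 : 'I_1), 0).
  exact: fiber_arg_vertical.
have aS k : (k < 3)%N -> fiber_arg (n := 1) u (inord k.+1) = (0, u (inord k)).
  move=> k3; apply: (fiber_arg_horizontal (n := 1) u (l := (inord k : 'I_3))).
    by [].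
  by rewrite inordK.
have K0 t k : (k < 3)%N -> kappa_fiber (n := 1) t p u 0 k.+1 = w k.
  by move=> k3; rewrite /kappa_fiber a0 aS // kappa_at_mixed l0.
have KS (t : 'rV_1) j k : (j < 3)%N -> (k < 3)%N ->
    kappa_fiber (n := 1) (barycentric t) p u j.+1 k.+1 =
    (t ord0 ord0 ^+ 2 - t ord0 ord0) *: bracket (w j) (w k).
  by move=> j3 k3; rewrite /kappa_fiber !aS // kappa_at_horizontal1.
set T := \tr _ - \tr _; set c := (8 * _)^-1.
(* A primitive of the integrand, as a polynomial in the coordinate t_1. *)
pose q : {poly R} := (- 6 * (c * T)) *: (3^-1 *: 'X^3 - 2^-1 *: 'X^2).
have qE s : (q^`()).[s] = - 6 * (s ^+ 2 - s) * (c * T).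
  rewrite derivZ derivB !derivZ !derivXn /=.
  rewrite !(hornerD, hornerN, hornerZ, hornerXn, hornerMn).
  by move: (c * T) => r; field.
transitivity (q.[1] - q.[0]); last first.
  rewrite !(hornerD, hornerN, hornerZ, hornerXn).
  by move: (c * T) => r; field.
rewrite -iter_integral_simplex1; congr iter_integral; apply/funext => t.
rewrite qE; congr (_ * _).
pose K := kappa_fiber (n := 1) (barycentric t) p u.
exact: (p1_square_horizontal (K := K) (K0 _) (KS t)).
Qed.

Lemma shulman2 (p : EGspace R m 2) (u : 'I_2 -> EGspace R m 2) : EG R m 2 p ->
  shulman (@p1 R m) 2 p u =
  p1 (omega_bar_at (inord 1) p (u ord_max)) (omega_bar_at (inord 2) p (u ord0))
  - p1 (omega_bar_at (inord 1) p (u ord0))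
       (omega_bar_at (inord 2) p (u ord_max)).
Proof.
move=> sp; rewrite shulman_p1E //.
have i1 : lift ord0 (ord0 : 'I_2) = inord 1.
  by apply: val_inj; rewrite /= inordK.
have i2 : lift ord0 (ord_max : 'I_2) = inord 2.
  by apply: val_inj; rewrite /= inordK.
have a0 : fiber_arg (n := 2) u (inord 0) = (partial R (ord0 : 'I_2), 0).
  exact: fiber_arg_vertical.
have a1 : fiber_arg (n := 2) u (inord 1) = (partial R (ord_max : 'I_2), 0).
  exact: fiber_arg_vertical.
have a2 : fiber_arg (n := 2) u (inord 2) = (0, u ord0).
  exact: (fiber_arg_horizontal (n := 2) u (l := (ord0 : 'I_2))).
have a3 : fiber_arg (n := 2) u (inord 3) = (0, u ord_max).
  exact: (fiber_arg_horizontal (n := 2) u (l := (ord_max : 'I_2))).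
rewrite -[RHS](mulfK (_ : 2 != 0)) ?pnatr_eq0 // -iter_integral_simplex2.
congr iter_integral; apply/funext => t; congr (_ * _) => /=.
rewrite kappa_fiber_vertical // p1_0l sub0r /kappa_fiber a0 a1 a2 a3.
rewrite !kappa_at_mixed i1 i2 mulrC addrC.
by congr ((_ - _) * _); exact: p1C.
Qed.

End Main.

Theorem corollary5p3p3 (R : realType) (m : nat) :
  [/\ eq_form (EG R m 1) (shulman (@p1 R m) 1)
        (fun p v => 1 / (24 * pi ^+ 2) *
          wedge (fun A B : 'M[R]_m => \tr (A *m B))
            (wedge (fun A B : 'M[R]_m => A *m B)
              (omega_bar R m 1 (inord 1)) (omega_bar R m 1 (inord 1)))
            (omega_bar R m 1 (inord 1)) p v),
      eq_form (EG R m 2) (shulman (@p1 R m) 2)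
        (fun p v => 1 / (8 * pi ^+ 2) *
          (wedge (fun A B : 'M[R]_m => \tr (A *m B))
             (omega_bar R m 2 (inord 1)) (omega_bar R m 2 (inord 2)) p v
           - wedge (fun A B : 'M[R]_m => \tr A * \tr B)
             (omega_bar R m 2 (inord 1)) (omega_bar R m 2 (inord 2)) p v))
    & forall n : nat, n <> 1%N -> n <> 2%N ->
        eq_form (EG R m n) (shulman (@p1 R m) n) (fun _ _ => 0)].
Proof.
split=> [p v sp _|p v sp _|n n1 n2 p v sp _].
- rewrite shulman1 //.
  have i1 : inord 1 = ord_max :> 'I_2 by apply: val_inj; rewrite /= inordK.
  rewrite i1.
  pose w := omega_bar_at (ord_max : 'I_2) p.
  rewrite (@wedge21 _ _ _ _ _ _ _ (fun x y => w x *m w y - w y *m w x) w);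
    last 2 first.
  - by move=> u; apply: wedge11 => u'; exact: omega_barE.
  - by move=> u; exact: omega_barE.
  rewrite /= -!/(w _).
  move: (w (v (inord 0))) (w (v (inord 1))) (w (v (inord 2))) => A B C.
  rewrite !mulmxBl !raddfB /=.
  have [-> -> -> ->] := mxtrace_mul3_cyclic A B C.
  have pi0 : (pi : R) != 0 by rewrite gt_eqF // pi_gt0.
  by move: (pi : R) pi0 (\tr _) (\tr _) => c c0 X Y; field.
- rewrite shulman2 //.
  pose w1 := omega_bar_at (inord 1 : 'I_3) p.
  pose w2 := omega_bar_at (inord 2 : 'I_3) p.
  rewrite !(@wedge11 _ _ _ _ _ _ _ _ w1 w2); try by move=> u; exact: omega_barE.
  rewrite !p1E div1r -mulrBr -!/(w1 _) -!/(w2 _); congr (_ * _).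
  move: (w1 _) (w1 _) (w2 _) (w2 _) => A A' B B'.
  move: (\tr (A *m B)) (\tr (A' *m B')) (\tr A) (\tr A') (\tr B) (\tr B').
  by move=> X X' a a' b b'; ring.
- case: n n1 n2 p v sp => [|[|[|n]]] // n1 n2 p v sp; first exact: shulman0.
  exact: shulman_ge3.
Qed.
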